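(* Let $F$ be a graph of order $r$ with $\chi(F)\geq 3$, $\beta_1(F)=1$ and without isolated vertices. Let $k\geq 2$, $\ell\geq 4$, $r\geq 3$ and $n\geq 4k^2\ell^2(k\ell+r)\left(\lfloor\frac{\ell}{2}\rfloor+1\right)\binom{\ell}{\lfloor \ell/2\rfloor}$. Then $$ex(n,\{F,kP_\ell\})=\left(n-k\left\lfloor\frac{\ell}{2}\right\rfloor+1\right)\left(k\left\lfloor\frac{\ell}{2}\right\rfloor-1\right)+C_{F,k,\ell},$$ where $C_{F,k,\ell}=0$ if the triple $(F,k,\ell)$ has property $\mathscr{P}$ and $C_{F,k,\ell}=1$ otherwise.
   Context: All graphs are finite and simple. $ex(n,\mathscr{F})$ is the maximum number of edges of an $n$-vertex graph containing no member of $\mathscr{F}$ as a subgraph. $P_\ell$ is the path on $\ell$ vertices and $kP_\ell$ is $k$ vertex-disjoint copies of it. $\chi$ is the chromatic number. An edge control set of $F$ is a set $E'\subseteq E(F)$ such that every edge not in $E'$ shares an endpoint with some edge in $E'$; $\beta_1(F)$ is the minimum size of an edge control set. When $\beta_1(F)=1$, let $\{u_1u_2\}$ be the edge control set of $F$ and set $f(F)=\min\{d_F(u_1),d_F(u_2)\}$. $N(F,K_3)$ is the number of triangles in $F$. The triple $(F,k,\ell)$ has property $\mathscr{P}$ if at least one of the following holds: (1) $\ell$ is even; (2) $v(F)=r\leq k\lfloor\frac{\ell}{2}\rfloor+1$; (3) $N(F,K_3)=1$ and $f(F)\leq k\lfloor\frac{\ell}{2}\rfloor$. *)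

(* Defs.v *)
From mathcomp Require Import all_boot all_order.
Set Implicit Arguments. Unset Strict Implicit. Unset Printing Implicit Defensive.

Section Graphs.
Variable V : finType.

Definition simple_graph (F : rel V) : Prop :=
  (forall x, ~~ F x x) /\ (forall x y, F x y = F y x).

Definition deg (F : rel V) (x : V) : nat := #|[set y | F x y]|.

Definition edges (F : rel V) : {set {set V}} :=
  [set e : {set V} | [exists x, exists y, F x y && (e == [set x; y])]].

Definition edge_control (F : rel V) (S : {set {set V}}) : bool :=
  (S \subset edges F) &&
  [forall e in edges F, (e \notin S) ==> [exists e' in S, e :&: e' != set0]].

(* beta_1(F): minimum size of an edge control set (edges F itself is one) *)
Definition beta1 (F : rel V) : nat :=
  find (fun m => [exists S : {set {set V}}, edge_control F S && (#|S| == m)])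
       (iota 0 (#|edges F|).+1).

(* proper colouring with k colours; chromatic number as least such k
   (V colours always suffice, via enum_rank) *)
Definition colorable (F : rel V) (k : nat) : bool :=
  [exists c : {ffun V -> 'I_k}, [forall x, forall y, F x y ==> (c x != c y)]].

Definition chi (F : rel V) : nat :=
  find (colorable F) (iota 0 #|V|.+1).

Definition ntriangles (F : rel V) : nat :=
  #|[set S : {set V} | (#|S| == 3) &&
      [forall x in S, forall y in S, (x != y) ==> F x y]]|.

End Graphs.

Definition contains (U W : finType) (G : rel W) (H : rel U) : bool :=
  [exists f : {ffun U -> W}, injectiveb f &&
     [forall x, forall y, H x y ==> G (f x) (f y)]].

Definition kPath (k l : nat) : rel ('I_k * 'I_l) :=
  fun p q => (p.1 == q.1) && ((p.2.+1 == q.2 :> nat) || (q.2.+1 == p.2 :> nat)).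

Definition relE (n : nat) (E : {set 'I_n * 'I_n}) : rel 'I_n :=
  fun x y => (x, y) \in E.

Definition simpleE (n : nat) (E : {set 'I_n * 'I_n}) : bool :=
  [forall x, (x, x) \notin E] &&
  [forall x, forall y, ((x, y) \in E) == ((y, x) \in E)].

Definition nedges (n : nat) (E : {set 'I_n * 'I_n}) : nat :=
  #|[set p in E | (p.1 < p.2)%N]|.

Definition ex_F_kP (n : nat) (U : finType) (F : rel U) (k l : nat) : nat :=
  \max_(E : {set 'I_n * 'I_n} | simpleE E && ~~ contains (relE E) F
                                   && ~~ contains (relE E) (@kPath k l))
     nedges E.

(* property P of the triple (F,k,l); f(F) <= k*floor(l/2) is expressed through
   an edge control set {u1u2} of size one (f is independent of the choice
   under the hypotheses) *)
Definition propP (r : nat) (F : rel 'I_r) (k l : nat) : bool :=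
  [|| ~~ odd l, (r <= k * l./2 + 1)%N |
   (ntriangles F == 1%N) &&
   [exists u1 : 'I_r, exists u2 : 'I_r, [&& F u1 u2,
      edge_control F [set [set u1; u2]] &
      (minn (deg F u1) (deg F u2) <= k * l./2)%N]]].

Definition C_Fkl (r : nat) (F : rel 'I_r) (k l : nat) : nat :=
  if propP F k l then 0 else 1.

(* Main.v *)
Require Import Defs.
From mathcomp Require Import all_boot all_order.
From mathcomp Require Import zify.
From Stdlib Require Import Classical.
Set Implicit Arguments. Unset Strict Implicit. Unset Printing Implicit Defensive.

(** Write h for the half of l rounded down and K = k h. The hypotheses on F say that
    every edge of F meets a fixed edge u1u2 lying in a triangle.

    Upper bound. If G has no kP_l and about (K - 1) n edges, then deleting a P_l
    leaves, by Erdős–Gallai and induction, too few edges unless many vertices see h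
    vertices of that path; iterating gives a set A' of (k - 1) h vertices whose
    removal destroys all P_l, so that about half of the vertices are common
    neighbours of A'. In G - A' no h disjoint paths with at least three vertices can
    have both ends in this set B of common neighbours; after removing a maximal
    family of such paths, every component (disregarding edges inside B) contains at
    most one vertex of B. The removed vertices seeing many of these components are
    fewer than h, and counting edges component by component (with Erdős–Gallai on the
    large ones) shows that there are exactly h - 1 of them and that, together with A',
    they form a set A of K - 1 vertices with many common neighbours. As G has no F,
    A is independent; as G has no kP_l, the edges outside A are compensated by
    missing edges to A, except possibly for one edge between two common neighbours
    of A when l is odd. Under property P such an edge would create F.

    Lower bound. The complete bipartite graph with parts of sizes K - 1 and
    n - K + 1, together with one edge inside the large part when property P fails. *)

(** * Paths and edge counts *)

(** Induction on the gap between [b] and the current value: a strictly larger value shrinks the gap.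
    [P] is an arbitrary proposition, hence the appeal to excluded middle. *)
Lemma max_exists (T : Type) (P : T -> Prop) (f : T -> nat) (b : nat) :
  (exists x, P x) -> (forall x, P x -> f x <= b) ->
  exists x, P x /\ forall y, P y -> f y <= f x.
Proof.
move=> [x0 Px0] fb; move: {2}(b - f x0) (leqnn (b - f x0)) => d.
elim: d x0 Px0 => [|d IHd] x Px hd.
  by exists x; split=> // y /fb; lia.
case: (classic (exists y, P y /\ f x < f y)) => [[y [Py lt_xy]]|no].
  by apply: (IHd y Py); lia.
exists x; split=> // y Py; rewrite leqNgt; apply/negP => lt_xy.
by apply: no; exists y.
Qed.

Section Lists.
Variables (T : eqType) (e : rel T).
Implicit Types (x : T) (s : seq T).

Lemma sorted_cat2 x s1 s2 : sorted e s1 -> sorted e s2 ->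
  (s1 != [::] -> s2 != [::] -> e (last x s1) (head x s2)) -> sorted e (s1 ++ s2).
Proof.
case: s1 => [|a s1] //= p1; case: s2 => [|b s2]; first by rewrite cats0.
by move=> /= p2 /(_ isT isT) eab; rewrite cat_path p1 /= eab.
Qed.

Lemma cycle_sorted x s : sorted e s -> e (last x s) (head x s) -> cycle e s.
Proof. by case: s => //= a s ps eas; rewrite rcons_path ps. Qed.

Lemma sorted_rev_sym s : symmetric e -> sorted e s -> sorted e (rev s).
Proof.
by move=> esym; rewrite rev_sorted; apply: sub_sorted => a b; rewrite /= esym.
Qed.

End Lists.

Section Count.
Variable V : finType.
Implicit Types (g : rel V) (S T X : {set V}) (x y : V) (p q : seq V).

Definition nbrs g T x : {set V} := [set y in T | g x y].

(* Ordered pairs are counted: ed g S S is twice the number of edges inside S. *)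
Definition ed g S T : nat := \sum_(x in S) \sum_(y in T) (g x y : nat).

Lemma sum_nbrs g T x : \sum_(y in T) (g x y : nat) = #|nbrs g T x|.
Proof.
rewrite -sum1_card big_mkcond [RHS]big_mkcond /=.
by apply: eq_bigr => y _; rewrite inE; case: (y \in T) => //=; case: (g x y).
Qed.

Lemma ed_nbrs g S T : ed g S T = \sum_(x in S) #|nbrs g T x|.
Proof. by apply: eq_bigr => x _; rewrite sum_nbrs. Qed.

Lemma edC g S T : symmetric g -> ed g S T = ed g T S.
Proof.
move=> gsym; rewrite /ed exchange_big /=.
by apply: eq_bigr => y _; apply: eq_bigr => x _; rewrite gsym.
Qed.

Lemma ed_splitl g X S T : ed g S T = ed g (S :&: X) T + ed g (S :\: X) T.
Proof. by rewrite /ed (big_setID X). Qed.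

Lemma ed_splitr g X S T : ed g S T = ed g S (T :&: X) + ed g S (T :\: X).
Proof. by rewrite /ed -big_split /=; apply: eq_bigr => x _; rewrite (big_setID X). Qed.

Lemma ed_leq g S T c : (forall x, x \in S -> #|nbrs g T x| <= c) -> ed g S T <= #|S| * c.
Proof. by move=> le_c; rewrite ed_nbrs -sum_nat_const leq_sum. Qed.

Lemma nbrs_leq g T x : #|nbrs g T x| <= #|T|.
Proof. by apply/subset_leq_card/subsetP => y; rewrite inE => /andP[]. Qed.

Lemma ed_leq_mul g S T : ed g S T <= #|S| * #|T|.
Proof. by apply: ed_leq => x _; apply: nbrs_leq. Qed.

Lemma ed_mono g g' S S' T T' : subrel g g' -> S \subset S' -> T \subset T' ->
  ed g S T <= ed g' S' T'.
Proof.
move=> gg' SS' TT'; rewrite (ed_splitl g' S S') (ed_splitr g' T (S' :&: S)).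
rewrite (setIidPr SS') (setIidPr TT') -addnA; apply: leq_trans (leq_addr _ _).
apply: leq_sum => x _; apply: leq_sum => y _.
by case E: (g x y) => //; rewrite (gg' _ _ E).
Qed.

Lemma ed_mono_in g g' S T :
  (forall x y, x \in S -> y \in T -> g x y -> g' x y) -> ed g S T <= ed g' S T.
Proof.
move=> gg'; apply: leq_sum => x xS; apply: leq_sum => y yT.
by case E: (g x y) => //; rewrite (gg' _ _ xS yT E).
Qed.

Lemma ed_eq0 g S T : (forall x y, x \in S -> y \in T -> ~~ g x y) -> ed g S T = 0.
Proof.
move=> no; apply: big1 => x xS; apply: big1 => y yT.
by rewrite (negbTE (no _ _ xS yT)).
Qed.

Lemma ed_split_sym g X S : symmetric g ->
  ed g S S = ed g (S :&: X) (S :&: X) + 2 * ed g (S :&: X) (S :\: X)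
             + ed g (S :\: X) (S :\: X).
Proof.
move=> gsym; rewrite (ed_splitl g X S S) (ed_splitr g X (S :&: X)).
by rewrite (ed_splitr g X (S :\: X)) (edC (S :\: X) (S :&: X) gsym); lia.
Qed.

Lemma ed_irr g S : irreflexive g -> ed g S S <= #|S| * (#|S| - 1).
Proof.
move=> girr; apply: ed_leq => x xS.
have -> : #|S| - 1 = #|S :\ x| by rewrite (cardsD1 x S) xS; lia.
apply/subset_leq_card/subsetP => y; rewrite !inE => /andP[-> gxy].
by rewrite andbT; apply: contraTneq gxy => ->; rewrite girr.
Qed.

(* A longest path in a graph of minimum degree at least h spans a component
   when it has at most 2h vertices: its two ends see at least 2h of its vertices,
   so it closes up into a cycle, and any edge leaving a spanning cycle would
   produce a longer path. *)
Lemma longest_path_closed g S h p : symmetric g -> irreflexive g ->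
  0 < h -> (forall x, x \in S -> h <= #|nbrs g S x|) ->
  sorted g p -> uniq p -> {subset p <= S} -> 0 < size p -> size p <= 2 * h ->
  (forall q, sorted g q -> uniq q -> {subset q <= S} -> size q <= size p) ->
  forall x y, x \in p -> y \in S -> y \notin p -> ~~ g x y.
Proof.
move=> gsym girr h0 mindeg.
case: p => // x0 p sp up pS _ szp maxp; rewrite /= in sp.
have cnt z (s : seq V) : (forall y, y \in S -> g z y -> y \in s) -> z \in S ->
    h <= count (g z) s.
  move=> sub zS; apply: leq_trans (mindeg z zS) _; rewrite -size_filter.
  apply: leq_trans (card_size _); apply/subset_leq_card/subsetP => y.
  by rewrite inE mem_filter => /andP[yS gzy]; rewrite gzy sub.
have x0S : x0 \in S by apply: pS; rewrite mem_head.
have xmS : last x0 p \in S by apply: pS; rewrite mem_last.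
have c0 : h <= count (g x0) p.
  apply: cnt => // y yS gxy; apply: contraT => ynp.
  have ynp' : y \notin x0 :: p.
    by rewrite inE negb_or ynp andbT; apply: contraTneq gxy => ->; rewrite girr.
  have := maxp (y :: x0 :: p); rewrite cons_uniq ynp' up [sorted _ _]/= gsym gxy sp.
  move=> /(_ isT isT) H; exfalso; suff: (size p).+2 <= (size p).+1 by rewrite ltnn.
  by apply: H => z; rewrite inE => /orP[/eqP->//|]; exact: pS.
have c1 : h <= count (g (last x0 p)) (belast x0 p).
  apply: cnt => // y yS gxy; apply: contraT => ynp.
  have ynp' : y \notin x0 :: p.
    rewrite lastI mem_rcons inE negb_or ynp andbT.
    by apply: contraTneq gxy => ->; rewrite girr.
  have := maxp (rcons (x0 :: p) y);
    rewrite rcons_uniq ynp' up [sorted _ _]/= rcons_path sp gxy.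
  rewrite size_rcons => /(_ isT isT) H; exfalso;
    suff: (size p).+2 <= (size p).+1 by rewrite ltnn.
  by apply: H => z; rewrite mem_rcons inE => /orP[/eqP->//|]; exact: pS.
(* The consecutive pairs of the path, at most 2h - 1 of them. At least h have their second entry
   adjacent to the first vertex and at least h their first entry adjacent to the last vertex, so
   some pair (u, v) has both properties. *)
pose zz := zip (belast x0 p) p.
have szz : size zz = size p by rewrite size_zip size_belast minnn.
have d0 : count [pred uv : V * V | g x0 uv.2] zz = count (g x0) p.
  by rewrite -[in RHS](@unzip2_zip _ _ (belast x0 p) p) ?size_belast // count_map.
have d1 : count [pred uv : V * V | g (last x0 p) uv.1] zz =
    count (g (last x0 p)) (belast x0 p).
  by rewrite -[in RHS](@unzip1_zip _ _ (belast x0 p) p) ?size_belast // count_map.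
have /hasP[[u v] uvz /andP[/= g1 g0]] : has (predI [pred uv : V * V | g (last x0 p) uv.1]
    [pred uv | g x0 uv.2]) zz.
  rewrite has_count; have := count_predUI [pred uv : V * V | g (last x0 p) uv.1]
    [pred uv | g x0 uv.2] zz.
  have := count_size (predU [pred uv : V * V | g (last x0 p) uv.1]
    [pred uv | g x0 uv.2]) zz.
  move: szp c0 c1; rewrite -d0 -d1 szz /=; lia.
have {uvz} [q1 [q2 Ep]] : exists q1 q2, x0 :: p = rcons q1 u ++ v :: q2.
  elim: (p) (x0) (uvz : (u, v) \in zip (belast x0 p) p) => // a s IHs b /=.
  rewrite inE => /orP[/eqP[-> ->]|/IHs [q1 [q2 E]]]; first by exists [::], s.
  by exists (b :: q1), q2; rewrite E.
have Eh : x0 = head x0 (rcons q1 u) by case: (q1) Ep => [|? ?] [].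
have El : last x0 p = last v q2.
  by rewrite -[last x0 p]/(last x0 (x0 :: p)) Ep last_cat.
(* Run from [x0] to [u], jump to the last vertex, run back to [v] and close up at [x0]: a cycle on
   the vertices of the path. *)
pose c := rcons q1 u ++ rev (v :: q2).
have Pc : perm_eq c (x0 :: p) by rewrite Ep perm_cat2l perm_rev.
have cyc : cycle g c.
  move: sp; rewrite -[path g x0 p]/(sorted g (x0 :: p)) Ep => spq.
  have [s1 s2] : sorted g (rcons q1 u) /\ sorted g (v :: q2).
    split.
      by have := take_sorted (size (rcons q1 u)) spq; rewrite take_size_cat.
    by have := drop_sorted (size (rcons q1 u)) spq; rewrite drop_size_cat.
  apply: (@cycle_sorted _ _ x0).
    apply: (@sorted_cat2 _ _ x0) => // [|_ _]; first exact: sorted_rev_sym.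
    by rewrite last_rcons lastI rev_rcons /= -El gsym.
  rewrite /c last_cat rev_cons last_rcons.
  by case: (q1) Eh => [|? ?] /= <-; rewrite gsym.
move=> x y xp yS ynp; apply/negP => gxy.
have xc : x \in c by rewrite (perm_mem Pc).
(* Opening the cycle at [x] and putting [y] in front gives a path longer than the longest one. *)
have [i c' Ec] := rot_to xc.
have Pc' : perm_eq (x :: c') (x0 :: p) by rewrite -Ec perm_rot.
have : cycle g (x :: c') by rewrite -Ec rot_cycle.
rewrite /= rcons_path => /andP[pc' _].
have := maxp (y :: x :: c').
rewrite cons_uniq (perm_mem Pc') ynp (perm_uniq Pc') up [sorted _ _]/= gsym gxy pc' =>
  /(_ isT isT) H.
have : (size c').+2 <= (size p).+1.
  apply: H => z; rewrite inE => /orP[/eqP->//|]; rewrite (perm_mem Pc'); exact: pS.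
by have [->] := perm_size Pc'; rewrite ltnn.
Qed.
End Count.

(** * The Erdős-Gallai bound for graphs without long paths *)

Section EG.
Variable V : finType.
Implicit Types (g : rel V) (S T X : {set V}) (x y : V) (p q : seq V).

(** Induction on |S|. A vertex of degree below h is removed at a cost of at most 2(h - 1) ordered
    pairs. If there is none, the vertex set of a longest path sends no edge outside, and having at
    most 2h vertices it carries at most 2h - 1 ordered pairs per vertex. *)
Lemma erdos_gallai g S h : symmetric g -> irreflexive g -> 0 < h ->
  (forall p, sorted g p -> uniq p -> {subset p <= S} -> size p <= 2 * h) ->
  ed g S S <= (2 * h - 1) * #|S|.
Proof.
move=> gsym girr h0; have [m] := ubnP #|S|; elim: m S => // m IHm S leSm noP.
have IH X : X \subset S -> X != set0 ->
    ed g (S :\: X) (S :\: X) <= (2 * h - 1) * (#|S| - #|X|).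
  move=> XS; rewrite -card_gt0 => X0.
  have cardD : #|S :\: X| = #|S| - #|X| by rewrite cardsD (setIidPr XS).
  rewrite -cardD; apply: IHm => [|p sp up pS].
    by have := subset_leq_card XS; move: leSm X0; rewrite cardD; clear; lia.
  by apply: noP => // x /pS; rewrite inE => /andP[].
have [->|S0] := eqVneq S set0; first by rewrite ed_eq0 // => x y; rewrite inE.
case: (classic (exists2 x, x \in S & #|nbrs g S x| < h)) => [[x xS dx]|mindeg].
  have xS' : [set x] \subset S by rewrite sub1set.
  have := IH [set x] xS'; rewrite -card_gt0 cards1 => /(_ isT) IHx.
  rewrite (ed_split_sym [set x] S gsym) (setIidPr xS').
  have -> : ed g [set x] [set x] = 0.
    by rewrite ed_eq0 // => a b; rewrite !inE => /eqP-> /eqP->; rewrite girr.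
  have dx' : ed g [set x] (S :\: [set x]) < h.
    apply: leq_ltn_trans dx; rewrite ed_nbrs big_set1.
    by apply/subset_leq_card/subsetP => y; rewrite !inE => /andP[/andP[_ ->] ->].
  have S1 : 0 < #|S| by rewrite card_gt0.
  have -> : #|S| = (#|S| - 1) + 1 by rewrite subnK.
  by rewrite mulnDr; move: IHx dx' h0; clear; lia.
have {}mindeg x : x \in S -> h <= #|nbrs g S x|.
  by move=> xS; rewrite leqNgt; apply/negP => dx; apply: mindeg; exists x.
have [x0 x0S] := set0Pn _ S0.
pose P p := [/\ sorted g p, uniq p, {subset p <= S} & 0 < size p].
have [p [[sp up pS p0] maxp]] : exists p, P p /\ forall q, P q -> size q <= size p.
  apply: (@max_exists _ P size (2 * h)) => [|q [sq uq qS _]]; last exact: noP.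
  by exists [:: x0]; split=> // y; rewrite inE => /eqP->.
have closed x y : x \in p -> y \in S -> y \notin p -> ~~ g x y.
  apply: (longest_path_closed (h := h)) => //; first exact: noP.
  by move=> [//|z q] sq uq qS; apply: maxp.
pose X := [set x in p].
have XS : X \subset S by apply/subsetP => x; rewrite inE => /pS.
have cardX : #|X| = size p by rewrite cardsE (card_uniqP up).
have X0 : X != set0 by rewrite -card_gt0 cardX.
rewrite (ed_split_sym X S gsym) (setIidPr XS).
rewrite (@ed_eq0 _ g X (S :\: X)); last first.
  by move=> x y; rewrite !inE => xp /andP[ynp yS]; apply: closed.
have := IH X XS X0; have := ed_irr X girr.
have := noP p sp up pS; rewrite -cardX => Xh e1 e2.
have -> : #|S| = #|X| + (#|S| - #|X|) by rewrite subnKC // subset_leq_card.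
rewrite mulnDr muln0 addn0; apply: leq_add e2; apply: leq_trans e1 _.
by rewrite mulnC leq_mul2r leq_sub2r ?orbT.
Qed.

End EG.

(** * Disjoint paths through a set with many common neighbours *)

Section Paths.
Variable V : finType.
Implicit Types (g : rel V) (S T X Y Z B : {set V}) (x y : V) (p q s xs : seq V).
Implicit Types (ss ps : seq (seq V)).

(* The vertices of X stay, isolated: every graph below has the same vertex set. *)
Definition del g X : rel V := fun x y => [&& x \notin X, y \notin X & g x y].

Definition cnbrs g X : {set V} := [set v | [forall x in X, g x v]].

(** The single [uniq] condition on the concatenation makes each path simple and the paths pairwise
    disjoint. *)
Definition haspaths g k l := exists ps, [/\ size ps = k,
  all (fun p => sorted g p && (size p == l)) ps & uniq (flatten ps)].

Lemma del_sym g X : symmetric g -> symmetric (del g X).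
Proof. by move=> gsym x y; rewrite /del gsym andbCA. Qed.

Lemma del_irr g X : irreflexive g -> irreflexive (del g X).
Proof. by move=> girr x; rewrite /del girr !andbF. Qed.

Lemma del_sub g X : subrel (del g X) g.
Proof. by move=> x y /and3P[]. Qed.

Lemma delS g X Y : X \subset Y -> subrel (del g Y) (del g X).
Proof.
move=> /subsetP XY x y /and3P[xY yY gxy]; apply/and3P; split=> //.
  by apply: contra xY; apply: XY.
by apply: contra yY; apply: XY.
Qed.

(** With two or more vertices every vertex of the path lies on an edge of [del g X]; a one-vertex
    path could still be a deleted, isolated vertex. *)
Lemma sorted_del_notin g X p : 1 < size p -> sorted (del g X) p ->
  forall x, x \in p -> x \notin X.
Proof.
case: p => [|a [|b p]] //= _ /andP[/and3P[aX bX _]].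
elim: p b bX => [|c p IHp] b bX /= pth x.
  by rewrite !inE => /orP[]/eqP->.
have /andP[/and3P[_ cX _] pth'] := pth.
have := IHp c cX pth' x; rewrite !inE => H /or4P[/eqP->|/eqP->|xc|xp] //; apply: H.
  by rewrite xc orbT.
by rewrite xp !orbT.
Qed.

Lemma haspathsS g g' k l : subrel g g' -> haspaths g k l -> haspaths g' k l.
Proof.
move=> gg' [ps [sz al un]]; exists ps; split=> //.
by apply: sub_all al => p /andP[sp ->]; rewrite (sub_sorted gg' sp).
Qed.

Lemma haspaths_cut g ps l :
  (forall p, p \in ps -> sorted g p && (l <= size p)) -> uniq (flatten ps) ->
  haspaths g (size ps) l.
Proof.
move=> al un; exists [seq take l p | p <- ps]; split; first by rewrite size_map.
  apply/allP => _ /mapP[p /al /andP[sp szp] ->].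
  by apply/andP; split; [exact: take_sorted | rewrite size_takel].
apply: subseq_uniq un; elim: ps {al} => //= p ps IHps.
by apply: cat_subseq IHps; apply: take_subseq.
Qed.

Lemma haspaths1 g p l : sorted g p -> uniq p -> l <= size p -> haspaths g 1 l.
Proof.
move=> sp up szp; apply: (@haspaths_cut g [:: p]); rewrite /= ?cats0 //.
by move=> q; rewrite inE => /eqP->; rewrite sp.
Qed.

Lemma size_flatten_const (ps : seq (seq V)) l :
  all (fun p => size p == l) ps -> size (flatten ps) = size ps * l.
Proof. by elim: ps => //= p ps IHps /andP[/eqP sz /IHps E]; rewrite size_cat sz E. Qed.

Lemma size_flatten_leq (ps : seq (seq V)) l :
  (forall p, p \in ps -> size p <= l) -> size (flatten ps) <= size ps * l.
Proof.
elim: ps => //= p ps IHps al; rewrite size_cat mulSn; apply: leq_add.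
  by apply: al; rewrite mem_head.
by apply: IHps => q qps; apply: al; rewrite inE qps orbT.
Qed.

Lemma choose_seq B m : m <= #|B| ->
  exists s, [/\ uniq s, size s = m & {subset s <= B}].
Proof.
move=> mB; exists (take m (enum B)); split.
- by rewrite take_uniq ?enum_uniq.
- by rewrite size_takel // -cardE.
- by move=> x /mem_take; rewrite mem_enum.
Qed.

Lemma card_set_seq s : #|[set x in s]| <= size s.
Proof. by rewrite cardsE card_size. Qed.

Lemma choose_seq_out B s m : m + size s <= #|B| ->
  exists t, [/\ uniq t, size t = m & forall x, x \in t -> x \in B /\ x \notin s].
Proof.
move=> mB; case: (@choose_seq (B :\: [set x in s]) m) => [|t [ut st tB]].
  rewrite cardsD; apply: leq_trans (leq_sub2l _ (subset_leq_card (subsetIr _ _))).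
  by have := card_set_seq s; move: mB; clear; lia.
by exists t; split=> // x /tB; rewrite !inE => /andP[].
Qed.

(** Pieces to be linked through vertices that see all of [B]; a single vertex of [B] is the shortest
    piece. *)
Definition seg g B s : bool :=
  if s is x :: s' then [&& path g x s', x \in B & last x s' \in B] else false.

(** Alternates pieces and linking vertices, starting and ending with a piece; it is applied with one
    piece more than links. *)
Fixpoint join xs ss : seq V :=
  if ss is s :: ss' then if xs is x :: xs' then s ++ x :: join xs' ss' else s
  else [::].

Lemma seg_join g B xs ss : symmetric g ->
  (forall a b, a \in xs -> b \in B -> g a b) ->
  all (seg g B) ss -> size ss = (size xs).+1 -> seg g B (join xs ss).
Proof.
move=> gsym; elim: xs ss => [|x xs IHxs] [|s ss] //= full /andP[ss1 ss2] [sz].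
  by [].
have {IHxs} := IHxs ss (fun a b ax bB => full a b (mem_behead (s := x :: _) ax) bB) ss2 sz.
case: s ss1 => // y s /= /and3P[pys yB lB]; case: (join xs ss) => // z t /=.
case/and3P=> pzt zB lzB; rewrite cat_path pys yB last_cat /= lzB pzt.
by rewrite (full x z) ?mem_head // gsym (full x (last y s)) ?mem_head.
Qed.

Lemma perm_join xs ss : size ss = (size xs).+1 -> perm_eq (join xs ss) (xs ++ flatten ss).
Proof.
elim: xs ss => [|x xs IHxs] [|s ss] //= [sz]; first by rewrite (size0nil sz) /= cats0.
by rewrite perm_catC /= perm_cons perm_catC perm_sym perm_catCA perm_cat2l perm_sym IHxs.
Qed.

Lemma seg_sorted g B s : seg g B s -> sorted g s.
Proof. by case: s => // x s /and3P[]. Qed.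

Lemma seg1 g B b : b \in B -> seg g B [:: b].
Proof. by rewrite /= => ->. Qed.

Lemma cnbrsP g X v : reflect (forall x, x \in X -> g x v) (v \in cnbrs g X).
Proof. by rewrite inE; apply: forall_inP. Qed.

Lemma cnbrs_notin g X v : irreflexive g -> v \in cnbrs g X -> v \notin X.
Proof. by move=> girr /cnbrsP H; apply/negP => /H; rewrite girr. Qed.

(** The j paths avoid [X] and occupy jl vertices, so h + 1 common neighbours of [X] remain free;
    alternating them with the h vertices of [X] gives a further path on 2h + 1 vertices, which is at
    least l. *)
Lemma extend_path1 g X j l h : symmetric g -> irreflexive g ->
  1 < l -> l <= 2 * h + 1 -> h < l -> #|X| = h -> j.+1 * l <= #|cnbrs g X| ->
  haspaths (del g X) j l -> haspaths g j.+1 l.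
Proof.
move=> gsym girr l1 lh hl cX cB [ps [sz al un]].
have notX x : x \in flatten ps -> x \notin X.
  case/flattenP=> p /(allP al) /andP[sp /eqP szp].
  by apply: (sorted_del_notin _ sp); rewrite szp.
have szf : size (flatten ps) = j * l.
  by rewrite -sz; apply: size_flatten_const; apply: sub_all al => p /andP[].
case: (@choose_seq_out (cnbrs g X) (flatten ps) h.+1) => [|bs [ubs szb bsB]].
  by rewrite szf; move: cB hl; rewrite mulSn; clear; lia.
pose p := join (enum X) [seq [:: b] | b <- bs].
have pp : perm_eq p (enum X ++ bs).
  by rewrite -[in X in perm_eq _ X](flatten_seq1 bs) perm_join // size_map szb -cardE cX.
have sp : seg g (cnbrs g X) p.
  apply: seg_join => //; last by rewrite size_map szb -cardE cX.
    by move=> a b; rewrite mem_enum => aX /cnbrsP; apply.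
  by apply/allP => _ /mapP[b /bsB[bB _] ->]; apply: seg1.
rewrite -sz -[(size ps).+1]/(size (p :: ps)); apply: haspaths_cut.
  move=> q; rewrite inE => /orP[/eqP->|/(allP al)/andP[sq /eqP->]].
    by rewrite (seg_sorted sp) (perm_size pp) size_cat -cardE cX szb; move: lh; clear; lia.
  by rewrite leqnn (sub_sorted (@del_sub g X) sq).
rewrite /= cat_uniq un (perm_uniq pp) cat_uniq enum_uniq ubs andbT /= andbT.
apply/andP; split.
  by apply/hasPn => b /bsB[bB _]; rewrite mem_enum; apply: cnbrs_notin bB.
apply/hasPn => x xf; rewrite (perm_mem pp) mem_cat negb_or mem_enum notX //=.
by apply/negP => /bsB[_]; rewrite xf.
Qed.

Lemma split_set X m : m <= #|X| ->
  exists X1, [/\ X1 \subset X, #|X1| = m & #|X :\: X1| = #|X| - m].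
Proof.
move=> /choose_seq [s [us szs sX]]; exists [set x in s].
have sub : [set x in s] \subset X by apply/subsetP => x; rewrite inE => /sX.
have c : #|[set x in s]| = m by rewrite cardsE (card_uniqP us).
by split=> //; rewrite cardsD (setIidPr sub) c.
Qed.

Lemma cnbrs_del g X1 X2 X : irreflexive g -> X1 \subset X -> X2 = X :\: X1 ->
  cnbrs g X \subset cnbrs (del g X1) X2.
Proof.
move=> girr /subsetP X1X ->; apply/subsetP => v vX; apply/cnbrsP => x.
rewrite inE => /andP[xX1 xX]; rewrite /del xX1 (cnbrsP _ _ _ vX) // andbT /=.
by apply: contra (cnbrs_notin girr vX); apply: X1X.
Qed.

Lemma cnbrs_sub g X1 X : X1 \subset X -> cnbrs g X \subset cnbrs g X1.
Proof.
move=> /subsetP X1X; apply/subsetP => v /cnbrsP vX; apply/cnbrsP => x /X1X; exact: vX.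
Qed.

(** [X] is peeled off in blocks of h vertices, each giving one more path. The induction runs in the
    graph without the current block, where the rest of [X] keeps its common neighbours. *)
Lemma extend_paths g X i j l h : symmetric g -> irreflexive g ->
  1 < l -> l <= 2 * h + 1 -> h < l -> #|X| = i * h -> (i + j) * l <= #|cnbrs g X| ->
  haspaths (del g X) j l -> haspaths g (i + j) l.
Proof.
move=> gsym girr l1 lh hl; elim: i g X gsym girr => [|i IHi] g X gsym girr cX cB hp.
  by apply: haspathsS hp; apply: del_sub.
case: (@split_set X h) => [|X1 [X1X cX1 cX2]]; first by rewrite cX mulSn leq_addr.
apply: (extend_path1 (X := X1) (h := h)) => //.
  by apply: leq_trans cB _; apply/subset_leq_card/cnbrs_sub.
apply: (IHi _ (X :\: X1)) => //.
- exact: del_sym.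
- exact: del_irr.
- by rewrite cX2 cX mulSn addKn.
- apply: leq_trans (subset_leq_card (cnbrs_del girr X1X (erefl _))).
  by apply: leq_trans cB; rewrite leq_mul2r addSn leqnSn orbT.
- apply: haspathsS hp => x y /and3P[xX yX gxy]; rewrite /del gxy !inE (negbTE xX) (negbTE yX).
  rewrite !andbF /= andbT; apply/andP; split.
    by apply: contra xX; apply/subsetP.
  by apply: contra yX; apply/subsetP.
Qed.

End Paths.

(** * Deleting vertices to destroy all long paths *)

Section Turan.
Variable V : finType.
Implicit Types (g : rel V) (S T X Y Z A B : {set V}) (x y : V) (p q s xs : seq V).
Notation n := #|V|.

Lemma ed_setC g A : irreflexive g -> symmetric g ->
  ed g setT setT = ed g A A + 2 * ed g A (~: A) + ed (del g A) setT setT.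
Proof.
move=> girr gsym; rewrite (ed_split_sym A setT gsym) setTI setTD; congr (_ + _).
apply/eqP; rewrite eqn_leq; apply/andP; split; last first.
  rewrite (ed_split_sym A setT (del_sym A gsym)) setTI setTD.
  rewrite (@ed_eq0 _ _ A A) => [|x y xA _]; last by rewrite /del xA.
  rewrite (@ed_eq0 _ _ A (~: A)) => [|x y xA _]; last by rewrite /del xA.
  by rewrite muln0 !add0n; apply: ed_mono => //; apply: del_sub.
rewrite /ed [leqLHS]big_mkcond [leqRHS]big_mkcond /=; apply: leq_sum => x _.
rewrite !inE; case xA: (x \in A) => //=.
rewrite [leqLHS]big_mkcond [leqRHS]big_mkcond /=; apply: leq_sum => y _.
by rewrite !inE /del xA; case: (y \in A).
Qed.

Lemma ed_del g A : irreflexive g -> symmetric g ->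
  ed g setT setT <= 2 * #|A| * n + ed (del g A) setT setT.
Proof.
move=> girr gsym; rewrite (ed_setC A girr gsym) leq_add2r.
have := ed_leq_mul g A A; have := ed_leq_mul g A (~: A).
have <- : #|A| + #|~: A| = n by rewrite cardsC.
rewrite mulnDr -!mulnA -(mulnDr 2); move: (#|A| * #|A|) (#|A| * _) => a b; clear; lia.
Qed.

(** A vertex outside [A] that is not a common neighbour misses some vertex of [A], so it sends at
    most |A| - 1 edges to [A]. *)
Lemma ed_cnbrs g A : irreflexive g -> symmetric g ->
  ed g setT setT <= #|A| * #|A| + 2 * (#|A| * #|cnbrs g A| +
    (#|A| - 1) * #|~: (A :|: cnbrs g A)|) + ed (del g A) setT setT.
Proof.
move=> girr gsym; rewrite (ed_setC A girr gsym) leq_add2r leq_add ?ed_leq_mul //.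
rewrite leq_mul2l /= (edC _ _ gsym) (ed_splitl g (cnbrs g A)).
have -> : ~: A :&: cnbrs g A = cnbrs g A.
  by apply/setIidPr/subsetP => v; rewrite in_setC; apply: cnbrs_notin.
have -> : ~: A :\: cnbrs g A = ~: (A :|: cnbrs g A) by rewrite setDE setCU.
rewrite mulnC [(_ - 1) * _]mulnC; apply: leq_add; apply: ed_leq => v;
  first by rewrite nbrs_leq.
rewrite in_setC in_setU negb_or => /andP[_];
  rewrite inE negb_forall_in => /exists_inP[x xA gxv].
have -> : #|A| - 1 = #|A :\ x| by rewrite (cardsD1 x A) xA addKn.
apply/subset_leq_card/subsetP => y; rewrite !inE => /andP[-> gvy]; rewrite andbT.
by apply: contraNneq gxv => <-; rewrite gsym.
Qed.

Lemma card_cnbrs g A : irreflexive g -> symmetric g ->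
  #|A| + #|cnbrs g A| + #|~: (A :|: cnbrs g A)| = #|V|.
Proof.
move=> girr gsym; rewrite -(cardsC (A :|: cnbrs g A)) cardsU.
rewrite (_ : A :&: cnbrs g A = set0) ?cards0 ?subn0 //.
by apply/setP => v; rewrite in_setI in_set0; apply/andP => -[vA /(cnbrs_notin girr)];
  rewrite vA.
Qed.

Variables (h l : nat).
Hypotheses (h2 : 2 <= h) (hl : 2 * h <= l <= 2 * h + 1).

(** A path with more than 2h vertices has at least l of them, so Erdős-Gallai applies. *)
Lemma path_free_ed g S : symmetric g -> irreflexive g -> ~ haspaths g 1 l ->
  ed g S S <= (2 * h - 1) * #|S|.
Proof.
move=> gsym girr no; apply: erdos_gallai => // [|p sp up _]; first by move: h2; clear; lia.
rewrite leqNgt; apply/negP => szp; apply: no; apply: (haspaths1 sp up).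
by move: hl szp; clear; lia.
Qed.

(** Pigeonhole: each vertex of [Y] selects h of its neighbours in [A], and the h-subset with the
    most common neighbours does at least as well as the average over all of them. *)
Lemma popular_subset g A Y : Y != set0 ->
  (forall y, y \in Y -> h <= #|nbrs g A y|) -> symmetric g ->
  exists X, [/\ X \subset A, #|X| = h & #|Y| <= 'C(#|A|, h) * #|cnbrs g X|].
Proof.
move=> /set0Pn[y0 y0Y] Yh gsym.
pose D := [set X : {set V} | X \subset A & #|X| == h].
have choose y : y \in Y -> exists2 X, X \in D & y \in cnbrs g X.
  move=> yY; have [X [sX cX _]] := split_set (Yh y yY).
  exists X; first rewrite inE cX eqxx andbT.
    apply: subset_trans sX _; apply/subsetP => x; by rewrite inE => /andP[].
  by apply/cnbrsP => x /(subsetP sX); rewrite inE gsym => /andP[].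
have [X0 X0D _] := choose y0 y0Y.
pose X := [arg max_(X > X0 in D) #|cnbrs g X|].
have [XD maxX] : X \in D /\ forall X', X' \in D -> #|cnbrs g X'| <= #|cnbrs g X|.
  by rewrite /X; case: arg_maxnP => // X1 X1D H; split=> // X'; apply: H.
exists X; move: (XD); rewrite inE => /andP[-> /eqP->]; split=> //.
rewrite -cards_draws -/D; apply: leq_trans (_ : \sum_(X' in D) #|cnbrs g X'| <= _); last first.
  by rewrite -sum_nat_const; apply: leq_sum => X' /maxX.
have -> : \sum_(X' in D) #|cnbrs g X'| = \sum_(y : V) \sum_(X' in D) (y \in cnbrs g X').
  rewrite exchange_big /=; apply: eq_bigr => X' _.
  by rewrite -sum1_card big_mkcond; apply: eq_bigr => y _; case: (y \in _).
rewrite -sum1_card big_mkcond /=; apply: leq_sum => y _.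
case: ifP => // /choose[X' X'D yX']; rewrite (bigD1 X') //= yX'; exact: leq_addr.
Qed.

Variables (k c : nat).
Hypothesis big : c + l ^ 2 + 2 * l * ('C(l, h) * (k * l)) < n.

(** In terms of edges, the density condition asks for (jh - 1)n of them up to a slack of c/2. *)
Definition deletable j := forall g, symmetric g -> irreflexive g -> ~ haspaths g j l ->
  (2 * (j * h) - 2) * n <= ed g setT setT + c ->
  exists A, #|A| <= (j - 1) * h /\ ~ haspaths (del g A) 1 l.

(** A denser graph would have a deletable set of at most (j - 1)h vertices, which meets at most 2(j
    - 1)hn ordered pairs; the rest contains no long path and has at most (2h - 1)n. *)
Lemma deletable_turan j g : deletable j -> 0 < j -> symmetric g -> irreflexive g ->
  ~ haspaths g j l -> ed g setT setT <= (2 * (j * h) - 1) * n.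
Proof.
move=> Dj j0 gsym girr no; rewrite leqNgt; apply/negP => gt.
have [|A [cA noA]] := Dj g gsym girr no.
  apply: leq_trans (leq_addr _ _); apply: leq_trans (ltnW gt).
  by rewrite leq_mul2r leq_sub2l ?orbT.
have := ed_del A girr gsym.
have := path_free_ed setT (del_sym A gsym) (del_irr A girr) noA; rewrite cardsT.
move=> e1 e2; move: gt; rewrite ltnNge; apply/negP; rewrite negbK.
apply: leq_trans e2 _; apply: leq_trans (leq_add (leqnn _) e1) _.
rewrite -mulnDl leq_mul2r; apply/orP; right.
move: cA; rewrite mulnBl; have : h <= j * h by rewrite leq_pmull.
by move: (j * h) h2; clear; lia.
Qed.

(** Induction on j: among the vertices of one long path, h of them have many common neighbours.
    Deleting these h vertices must lower the number of disjoint paths, since [extend_path1] could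
    otherwise add one, and the induction hypothesis supplies the other vertices. *)
Lemma deletableP j : 0 < j <= k -> deletable j.
Proof.
case: j => // j; elim: j => [|j IHj] /andP[_ jk] g gsym girr no big_e.
  by exists set0; rewrite cards0; split=> // hp; apply: no; apply: haspathsS hp;
    apply: del_sub.
have {IHj} Dj : deletable j.+1 by apply: IHj; exact: ltnW.
have Uj := deletable_turan Dj (ltn0Sn j).
have jh : h <= j.+1 * h by rewrite leq_pmull.
have Ejh : j.+2 * h = j.+1 * h + h by rewrite mulSn addnC.
(* Without a path on l vertices, Erdős-Gallai would allow only (2h - 1)n ordered pairs, below the
   assumed density. *)
have [ps [sz /allP al un]] : haspaths g 1 l.
  apply: NNPP => no1; have := path_free_ed setT gsym girr no1; rewrite cardsT => e1.
  have : (4 * h - 2) * n <= (2 * (j.+2 * h) - 2) * n.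
    by rewrite leq_mul2r Ejh; apply/orP; right; move: (j.+1 * h) jh; clear; lia.
  have -> : 4 * h - 2 = (2 * h - 1) + (2 * h - 1) by clear; lia.
  rewrite mulnDl => e2; have : n <= (2 * h - 1) * n by rewrite leq_pmull //; move: h2;
    clear; lia.
  move: e1 e2 big big_e.
  move: n (2 * l * _) (l ^ 2) ((2 * (j.+2 * h) - 2) * n) ((2 * h - 1) * n) (ed _ _ _).
  by clear; lia.
case: ps sz al un => [|p []] // _ al; rewrite /= cats0 => up.
have /andP[sp /eqP szp] := al p (mem_head _ _).
pose A := [set x in p]; have cA : #|A| = l by rewrite cardsE (card_uniqP up).
have noA : ~ haspaths (del g A) j.+1 l.
  move=> [ps [sz al' un]]; apply: no; exists (p :: ps); split; first by rewrite /= sz.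
    rewrite /= sp szp eqxx; apply: sub_all al' => q /andP[sq ->].
    by rewrite (sub_sorted (@del_sub _ g A) sq).
  rewrite /= cat_uniq up un andbT /=;
    apply/hasPn => x /flattenP[q /(allP al')/andP[sq /eqP szq] xq].
  have := sorted_del_notin _ sq xq; rewrite inE; apply; rewrite szq.
  by move: hl h2; clear; lia.
have e1 := Uj _ (del_sym A gsym) (del_irr A girr) noA.
(* Every vertex outside the path and outside [Y] receives at most h - 1 edges from the path. *)
pose Y := [set y in ~: A | h <= #|nbrs g A y|].
have e2 : ed g A (~: A) <= #|Y| * l + n * (h - 1).
  rewrite (edC _ _ gsym) (ed_splitl g Y); apply: leq_add.
    have -> : ~: A :&: Y = Y by apply/setIidPr/subsetP => y; rewrite !inE => /andP[].
    by apply: ed_leq => y _; rewrite -cA nbrs_leq.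
  apply: leq_trans (_ : #|~: A :\: Y| * (h - 1) <= _); last by rewrite leq_mul2r max_card orbT.
  apply: ed_leq => y /setDP[yA]; rewrite inE yA /= -ltnNge.
  by move: h2; clear; lia.
have e3 : ed g A A <= l ^ 2 by rewrite -mulnn -cA ed_leq_mul.
have e0 := ed_setC A girr gsym.
(* The assumed density exceeds the bound for the graph without the path, plus h - 1 edges per
   vertex, by n ordered pairs. Only the slack, the pairs inside the path and [Y] can supply them. *)
have nY : n <= c + l ^ 2 + 2 * l * #|Y|.
  move: big_e; rewrite e0 Ejh => e4.
  have Em : 2 * (j.+1 * h + h) - 2 = (2 * (j.+1 * h) - 1) + (1 + 2 * (h - 1)).
    by move: jh h2; move: (j.+1 * h); clear; lia.
  have e5 : 2 * (n * (h - 1)) = 2 * (h - 1) * n by rewrite mulnAC mulnA.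
  rewrite Em mulnDl mulnDl mul1n -e5 in e4; move: e1 e2 e3 e4.
  rewrite -(mulnA 2) (mulnC l).
  move: n (l ^ 2) (_ * l) (n * _) ((_ - 1) * n) (ed _ _ _) (ed _ _ _) (ed _ _ _); clear; lia.
have Y0 : Y != set0.
  apply/eqP => Y0; move: nY big; rewrite Y0 cards0 muln0 addn0.
  by move: n (l ^ 2) (2 * l * _); clear; lia.
have [|X [XA cX leY]] := popular_subset (A := A) Y0 _ gsym.
  by move=> y; rewrite inE => /andP[].
rewrite cA in leY.
have MX : k * l <= #|cnbrs g X|.
    rewrite leqNgt; apply/negP => lt; move: big; rewrite ltnNge; apply/negP; rewrite negbK.
    apply: leq_trans nY _; rewrite leq_add2l leq_mul2l; apply/orP; right.
    by apply: leq_trans leY _; rewrite leq_mul2l (ltnW lt) orbT.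
  have noX : ~ haspaths (del g X) j.+1 l.
    move=> hp; apply: no; apply: (extend_path1 (X := X) (h := h)) => //.
    - by move: hl h2; clear; lia.
    - by case/andP: hl.
    - by move: hl h2; clear; lia.
    - by apply: leq_trans MX; rewrite leq_mul2r jk orbT.
  (* Deleting h vertices destroys at most 2hn ordered pairs, exactly the drop of the density
     threshold from j + 2 to j + 1. *)
  have [|A' [cA' noA']] := Dj _ (del_sym X gsym) (del_irr X girr) noX.
    have := ed_del X girr gsym; rewrite cX; move: big_e; rewrite Ejh.
    have -> : 2 * (j.+1 * h + h) - 2 = (2 * (j.+1 * h) - 2) + 2 * h.
      by move: jh h2; move: (j.+1 * h); clear; lia.
    rewrite mulnDl; move: (2 * h * n) ((_ - 2) * n) (ed _ _ _) (ed _ _ _); clear; lia.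
  exists (X :|: A'); split.
    apply: leq_trans (leq_card_setU _ _) _; rewrite cX.
    by move: cA'; rewrite !subn1 /= mulSn leq_add2l.
  move=> hp; apply: noA'; apply: haspathsS hp => x y; rewrite /del !inE !negb_or.
  by case/and3P=> /andP[-> ->] /andP[-> ->] ->.
Qed.

End Turan.

(** * Segments and components outside the common neighbourhood *)

(** The letters stand for the set sizes and edge counts that [component_count] puts in; [c], [t] and
    [bb] are error terms. The leading terms cancel. Writing h = h' + 2 and a = a' + 1 and treating
    products such as a'n as atoms makes the estimate linear. *)
Lemma component_arith h a n B Z D NB NZ M T LB LZ t c e e1 e4 bb :
  2 <= h -> 0 < a -> n = a + B + Z -> n = NB + NZ + M ->
  (2 * (a + h) - 2) * n <= e + c ->
  e <= a * a + 2 * (a * B + (a - 1) * Z) + e1 ->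
  e1 <= e4 + D -> D = NB + LB ->
  e4 <= 2 * NZ + 2 * (NB * (h - 2) + t + NZ * (h - 1)) + (2 * h - 1) * M ->
  M <= a + T + LB + LZ -> NZ + LZ <= Z -> 2 * LB <= LZ + bb -> B <= T + D ->
  e1 <= (2 * h - 1) * n ->
  n <= 7 * c + 8 * a + 8 * T + 8 * t + 6 * bb.
Proof.
move=> h2 a0 En En' H1 H2 H3 ED H4 H5 H6 H7 H8 H9.
have [h' Eh] : exists h', h = h' + 2 by exists (h - 2); rewrite subnK.
have [a' Ea] : exists a', a = a' + 1 by exists (a - 1); rewrite subnK.
have E1 : a' * n = a' * a + a' * B + a' * Z by rewrite En !mulnDr.
have E2 : h' * n = h' * NB + h' * NZ + h' * M by rewrite En' !mulnDr.
subst a h.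
have {}H1 : 2 * (a' * n) + 2 * (h' * n) + 4 * n <= e + c.
  apply: leq_trans H1; apply: eq_leq; clear.
  by rewrite (_ : _ - 2 = 2 * a' + 2 * h' + 4); lia.
have {}H2 : e <= a' * (a' + 1) + (a' + 1) + 2 * (a' * B) + 2 * B + 2 * (a' * Z) + e1.
  by apply: leq_trans H2 _; rewrite addnK; clear; lia.
have {}H4 : e4 <= 2 * NZ + 2 * (h' * NB) + 2 * t + 2 * (h' * NZ) + 2 * NZ + 2 * (h' * M) + 3
  * M.
  apply: leq_trans H4 _; clear; rewrite addnK (_ : h' + 2 - 1 = h' + 1); last by lia.
  by rewrite (_ : _ - 1 = 2 * h' + 3); lia.
have {}H9 : e1 <= 2 * (h' * n) + 3 * n.
  by apply: leq_trans H9 _; clear; rewrite (_ : _ - 1 = 2 * h' + 3); lia.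
move: (a' * (a' + 1)) (a' * B) (a' * Z) (a' * n) (h' * n) (h' * NB) (h' * NZ) (h' * M)
  E1 E2 H1 H2 H4 H9 => x1 x2 x3 x4 x5 x6 x7 x8 E1 E2 H1 H2 H4 H9.
by move: En En' H3 ED H5 H6 H7 H8 E1 E2 H1 H2 H4 H9; clear; lia.
Qed.

Section Segments.
Variable V : finType.
Implicit Types (g : rel V) (S T X Y Z A B W : {set V}) (x y b v w : V).
Implicit Types (p q s xs : seq V) (ss : seq (seq V)).

Lemma segS g g' B s : subrel g g' -> seg g B s -> seg g' B s.
Proof. by move=> gg'; case: s => //= x s /and3P[ps -> ->]; rewrite (sub_path gg' ps). Qed.

Variables (g : rel V) (A : {set V}) (h l k : nat).
Hypotheses (gsym : symmetric g) (girr : irreflexive g).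
Hypotheses (h2 : 2 <= h) (hl : 2 * h <= l <= 2 * h + 1) (k2 : 2 <= k).
Hypothesis cardA : #|A| = (k - 1) * h.
Hypothesis noP : ~ haspaths g k l.
Hypothesis noP1 : ~ haspaths (del g A) 1 l.
Notation B := (cnbrs g A).
Notation g1 := (del g A).
Hypothesis bigB : k * l + h * l + 2 <= #|B|.

(** Replacing one common neighbour in an alternating path by such a segment gains at least two
    vertices, as much as one more vertex of [A] would. *)
Definition longseg s : bool := seg g1 B s && (2 < size s).

Definition segfamily ss : bool := all longseg ss && uniq (flatten ss).

Lemma longseg_size s : longseg s -> uniq s -> size s <= l.
Proof.
case/andP=> /seg_sorted ss _ us; rewrite leqNgt; apply/negP => lt; apply: noP1.
exact: haspaths1 ss us (ltnW lt).
Qed.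

Lemma uniq_flatten_mem ss s : uniq (flatten ss) -> s \in ss -> uniq s.
Proof.
elim: ss => //= s' ss IHss; rewrite cat_uniq => /and3P[us _ uss].
by rewrite inE => /orP[/eqP->|/IHss]; last exact.
Qed.

Lemma segfamily_size ss : segfamily ss -> size (flatten ss) <= size ss * l.
Proof.
case/andP=> /allP al un; apply: size_flatten_leq => s sss.
exact: longseg_size (al s sss) (uniq_flatten_mem un sss).
Qed.

(* Each long segment plays the role of a vertex of A: the h segments and h further
   vertices of A are spread over two paths so that both contain h of these
   2h special objects. *)
Lemma no_segfamily ss : segfamily ss -> size ss <> h.
Proof.
move=> fam szs; have szf := segfamily_size fam; have /andP[/allP al un] := fam; apply: noP.
(* [X] is kept aside for k - 2 of the paths; the other h vertices of [A] and the h segments build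
   the last two. *)
have [|X [XA cX cA1]] := @split_set _ A ((k - 2) * h).
  by rewrite cardA leq_mul2r leq_sub2l ?orbT.
have -> : k = (k - 2) + 2 by rewrite subnK.
apply: (extend_paths (X := X) (h := h)) => //; try by move: h2 hl; clear; lia.
  rewrite subnK //; apply: leq_trans (subset_leq_card (cnbrs_sub g XA)).
  by apply: leq_trans bigB; rewrite -addnA leq_addr.
have [|bs [ubs szb bsB]] := @choose_seq_out _ B (flatten ss) 2.
  by apply: leq_trans bigB; move: szf; rewrite szs; move: (k * l) (h * l); clear; lia.
set g' := del g X; have g'sym : symmetric g' by apply: del_sym.
pose xs := enum (A :\: X).
have szx : size xs = h.
  rewrite -cardE cA1 cardA -mulnBl (_ : k - 1 - (k - 2) = 1) ?mul1n //.
  by move: k2; clear; lia.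
have full a b : a \in xs -> b \in B -> g' a b.
  rewrite mem_enum inE => /andP[aX aA] bB; rewrite /g' /del aX (cnbrsP _ _ _ bB) // andbT /=.
  by apply: contra (cnbrs_notin girr bB); apply/subsetP.
(* The first path gets i1 links and i2 segments, the second i2 links and i1 segments. With m = i1 +
   1 - i2 and 2 - m single common neighbours respectively, each has one piece more than links and at
   least 2h + 1 vertices. *)
pose i1 := h./2; pose i2 := h - i1.
have [e1 e2 e3] : [/\ i1 <= i2, i2 <= i1 + 1 & i1 + i2 = h].
  rewrite /i2 /i1; have := odd_double_half h; rewrite -muln2; move: h./2 => z.
  by case: (odd h) => E; split; move: E; clear; lia.
clearbody i2; clearbody i1; pose m := i1 + 1 - i2.
have m2 : m <= 2 by rewrite /m; move: e2 e1; clear; lia.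
pose sing (s : seq V) := [seq [:: b] | b <- s].
pose ss1 := take i2 ss ++ sing (take m bs); pose ss2 := drop i2 ss ++ sing (drop m bs).
have sz1 : size ss1 = (size (take i1 xs)).+1.
  rewrite size_cat size_map !size_takel ?szb ?szs ?szx //; last first.
  - by move: e3; clear; lia.
  - by move: e3; clear; lia.
  by rewrite /m; move: e2; clear; lia.
have sz2 : size ss2 = (size (drop i1 xs)).+1.
  rewrite size_cat size_map !size_drop szb szs szx /m.
  by move: e1 e2 e3; clear; lia.
have allseg s : s \in ss ++ sing bs -> seg g' B s.
  rewrite mem_cat => /orP[/al/andP[sgs _]|/mapP[b /bsB[bB _] ->]]; last exact: seg1.
  by apply: segS sgs; apply: delS.
have al1 : all (seg g' B) ss1.
  apply/allP => s; rewrite mem_cat => H; apply: allseg; rewrite mem_cat.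
  case/orP: H => [/mem_take->//|/mapP[b /mem_take bb ->]].
  by apply/orP; right; apply: map_f.
have al2 : all (seg g' B) ss2.
  apply/allP => s; rewrite mem_cat => H; apply: allseg; rewrite mem_cat.
  case/orP: H => [/mem_drop->//|/mapP[b /mem_drop bb ->]].
  by apply/orP; right; apply: map_f.
have p1 := perm_join sz1; have p2 := perm_join sz2.
have long ss' : {subset ss' <= ss} -> 3 * size ss' <= size (flatten ss').
  elim: ss' => //= s ss' IHs sub; rewrite size_cat mulnS; apply: leq_add.
    by have /al/andP[_] := sub s (mem_head _ _).
  by apply: IHs => z zs; apply: sub; rewrite inE zs orbT.
have l1 : 3 * i2 <= size (flatten (take i2 ss)).
  have := long (take i2 ss) (fun s => @mem_take _ _ _ _); rewrite size_takel //.
  by rewrite szs; move: e3; clear; lia.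
have l2 : 3 * i1 <= size (flatten (drop i2 ss)).
  have := long (drop i2 ss) (fun s => @mem_drop _ _ _ _); rewrite size_drop szs.
  by rewrite -e3 addnK.
have fs1 : flatten ss1 = flatten (take i2 ss) ++ take m bs by rewrite flatten_cat flatten_seq1.
have fs2 : flatten ss2 = flatten (drop i2 ss) ++ drop m bs by rewrite flatten_cat flatten_seq1.
apply: (haspaths_cut (ps := [:: join (take i1 xs) ss1; join (drop i1 xs) ss2])).
  move=> p; rewrite !inE => /orP[]/eqP->.
    have := seg_join g'sym (fun a b ax => full a b (mem_take ax)) al1 sz1.
    move/seg_sorted=> ->; rewrite (perm_size p1) fs1 !size_cat !size_takel ?szx ?szb //;
      last first.
      by move: e3; clear; lia.
    move: hl l1 e1 e2 e3; rewrite /m /=; move: (size _) => z; clear; lia.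
  have := seg_join g'sym (fun a b ax => full a b (mem_drop ax)) al2 sz2.
  move/seg_sorted=> ->; rewrite (perm_size p2) fs2 !size_cat !size_drop szx szb.
  by move: hl l2 e1 e2 e3; rewrite /m /=; move: (size _) => z; clear; lia.
rewrite /= cats0.
have : perm_eq (join (take i1 xs) ss1 ++ join (drop i1 xs) ss2) (xs ++ (flatten ss ++ bs)).
  apply: perm_trans (perm_cat p1 p2) _; apply/permP => a; rewrite fs1 fs2 !count_cat.
  have := congr1 (count a) (cat_take_drop i1 xs); rewrite count_cat.
  have := congr1 (count a) (cat_take_drop m bs); rewrite count_cat.
  have := congr1 (count a) (congr1 flatten (cat_take_drop i2 ss));
    rewrite flatten_cat count_cat.
  by clear; lia.
move/perm_uniq->; rewrite !cat_uniq enum_uniq un ubs /= andbT; apply/andP; split; last first.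
  by apply/hasPn => b /bsB[].
rewrite has_cat negb_or; apply/andP; split.
  apply/hasPn => x /flattenP[s /al/andP[/seg_sorted sgs szs'] xs'].
  rewrite mem_enum inE negb_and orbC.
  by rewrite (sorted_del_notin (ltnW szs') sgs xs').
apply/hasPn => b /bsB[bB _]; rewrite mem_enum inE negb_and orbC.
by rewrite (cnbrs_notin girr bB).
Qed.

(** A largest family among those with at most h members has fewer than h, so one more disjoint
    segment would still be within the bound. *)
Lemma maximal_segfamily : exists ss, [/\ segfamily ss, size ss < h &
  forall s, longseg s -> uniq s -> has (mem (flatten ss)) s].
Proof.
have [|ss [sz _]|ss [[sz fam] maxss]] :=
  @max_exists _ (fun ss => size ss <= h /\ segfamily ss) size h.
- by exists [::]; split.
- exact: sz.
have lt : size ss < h by rewrite ltn_neqAle sz andbT; apply/eqP; apply: no_segfamily.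
exists ss; split=> // s ls us; apply: contraT => disj.
have /andP[al un] := fam.
have := maxss (s :: ss); rewrite ltnn; apply; split=> //.
rewrite /segfamily /= ls al cat_uniq us un andbT /=.
by rewrite andbT; apply: contra disj => /hasP[x xf xs]; apply/hasP; exists x.
Qed.

(** * Components after removing a maximal family of long segments *)

Section Components.
Variable ss0 : seq (seq V).
Hypothesis fam0 : segfamily ss0.
Hypothesis size0 : size ss0 < h.
Hypothesis max0 : forall s, longseg s -> uniq s -> has (mem (flatten ss0)) s.

Definition hit : {set V} := [set x in flatten ss0].
Notation T := hit.
Notation D := (B :\: T).

(* The edges inside D form a matching (nbrs_DD) and are counted apart, so that
   components contain at most one vertex of D. *)
Definition nodd : rel V := fun x y => g1 x y && ~~ ((x \in D) && (y \in D)).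
Notation gc := (del nodd T).
Definition cmp b : {set V} := [set v | connect gc b v].

Lemma nodd_sym : symmetric nodd.
Proof. by move=> x y; rewrite /nodd (del_sym A gsym) (andbC (x \in D)). Qed.

Lemma nodd_sub : subrel nodd g1. Proof. by move=> x y /andP[]. Qed.

Lemma gc_connect_sym : connect_sym gc.
Proof. exact/sym_connect_sym/del_sym/nodd_sym. Qed.

Lemma card_hit : #|T| <= h * l.
Proof.
apply: leq_trans (card_set_seq _) _; apply: leq_trans (segfamily_size fam0) _.
by rewrite leq_mul2r ltnW ?orbT.
Qed.

Lemma connect_path b v : b \in D -> connect gc b v -> exists q,
  [/\ sorted g1 (b :: q), uniq (b :: q), last b q = v,
      forall x, x \in b :: q -> connect gc b x /\ x \notin T &
      sorted nodd (b :: q)].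
Proof.
move=> bD /connectP[q0 pq0 ->]; case/shortenP: pq0 => q pq uq _.
have pn : sorted nodd (b :: q) by exact: (sub_path (@del_sub _ nodd T) pq).
exists q; split=> //; first exact: (sub_path nodd_sub pn).
move=> x xq; split.
  by apply: (path_connect pq xq).
case: q pq xq {uq pn} => [|y q] pq.
  by rewrite inE => /eqP->; case/setDP: bD.
exact: (sorted_del_notin (g := nodd) (p := b :: y :: q)).
Qed.

Lemma cmp_notin b v : b \in D -> connect gc b v -> v \notin A /\ v \notin T.
Proof.
move=> bD /(connect_path bD)[q [sq uq lq H _]].
have vq : v \in b :: q by rewrite -lq mem_last.
split; last by have [] := H v vq.
case: q {uq H lq} sq vq => [|y q] sq.
  by rewrite inE => /eqP->; apply: cnbrs_notin girr _; case/setDP: bD.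
by apply: (sorted_del_notin _ sq).
Qed.

Lemma max0_out s : longseg s -> uniq s -> exists2 x, x \in s & x \in T.
Proof. by move=> ls us; have /hasP[x xs xf] := max0 ls us; exists x; rewrite ?inE. Qed.

(** A connecting path with three or more vertices would be a long segment avoiding the maximal
    family; one with two vertices would be an edge inside [D], absent from [nodd]. *)
Lemma cmp_D b b' : b \in D -> b' \in D -> connect gc b b' -> b = b'.
Proof.
move=> bD b'D /(connect_path bD)[q [sq uq lq H pn]].
case: q sq uq lq H pn => [|y [|z q]] sq uq lq H pn //.
  by move: pn lq => /= /andP[/andP[_ +] _] E; rewrite E bD b'D.
have [] : False; have [|x xq xT] := max0_out _ uq; last first.
  by have [_] := H x xq; rewrite xT.
have /setDP[bB _] := bD; have /setDP[b'B _] := b'D.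
by rewrite /longseg /= andbT bB; apply/andP; split=> //; move: lq => /= ->.
Qed.

(** Two neighbours of b in [D] would form, with b in the middle, a long segment disjoint from the
    maximal family. *)
Lemma nbrs_DD b : b \in D -> #|nbrs g1 D b| <= 1.
Proof.
move=> bD; rewrite leqNgt; apply/negP => /card_gt1P[x [y []]].
rewrite ![_ \in nbrs _ _ _]inE => /andP[/setDP[xB xT] gbx] /andP[/setDP[yB yT] gby] xy.
have us : uniq [:: x; b; y].
  rewrite /= !inE negb_or xy !andbT /=; apply/andP; split.
    by apply: contraTneq gbx => ->; rewrite del_irr.
  by apply: contraTneq gby => ->; rewrite del_irr.
have ls : longseg [:: x; b; y] by rewrite /longseg /= (del_sym A gsym) gbx gby xB yB.
have [z] := max0_out ls us; have /setDP[_ bT] := bD.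
move: xT yT bT; rewrite !inE => xT yT bT.
by case/or3P=> /eqP->; apply/negP.
Qed.

(** A component meeting [D] is represented by its unique vertex in [D], so the size of this set is
    the number of such components adjacent to w. *)
Definition touch w : {set V} := [set b in D | [exists v, connect gc b v && g1 w v]].
Definition heavy : {set V} := [set w in T | 2 * h <= #|touch w|].
Notation W := heavy.

Lemma segs_through_heavy ws : uniq ws -> {subset ws <= W} -> size ws <= h ->
  exists bs ss, [/\ uniq bs, {subset bs <= D}, size bs = 2 * size ws,
    segfamily ss /\ size ss = size ws &
    forall x, x \in flatten ss -> x \in ws \/ exists2 b, b \in bs & connect gc b x].
Proof.
elim: ws => [|w ws IHws] /=; first by move=> _ _ _; exists [::], [::]; split.
case/andP=> wws uws sub szw.
have [|bs [ss [ubs bsD szb [fam szs] cov]]] := IHws uws _ (ltnW szw).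
  by move=> x xs; apply: sub; rewrite inE xs orbT.
have := sub w (mem_head _ _); rewrite inE => /andP[wT tw].
have [|bb [ubb szbb bbP]] := @choose_seq_out _ (touch w) bs 2.
  by rewrite szb -mulnS; apply: leq_trans tw; rewrite leq_mul2l szw orbT.
case: bb ubb szbb bbP => [|b1 [|b2 []]] //= ; rewrite inE andbT => b12 _ bbP.
have [t1 nb1] := bbP b1 (mem_head _ _).
have [t2 nb2] : b2 \in touch w /\ b2 \notin bs by apply: bbP; rewrite !inE eqxx orbT.
move: t1 t2; rewrite ![_ \in touch w]inE.
move=> /andP[b1D /existsP[v1 /andP[c1 gw1]]] /andP[b2D /existsP[v2 /andP[c2 gw2]]].
have [q1 [sq1 uq1 lq1 H1 _]] := connect_path b1D c1.
have [q2 [sq2 uq2 lq2 H2 _]] := connect_path b2D c2.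
pose s := (b1 :: q1) ++ w :: rev (b2 :: q2).
have wsT x : x \in ws -> x \in T.
  by move=> xw; have := sub x; rewrite in_cons xw orbT => /(_ isT); rewrite inE => /andP[].
have famT x : x \in flatten ss -> x \notin b1 :: q1 /\ x \notin b2 :: q2.
  case/cov=> [/wsT xT|[b bbs cbx]].
    by split; apply/negP; [move=> /H1 | move=> /H2] => -[_]; rewrite xT.
  have bD := bsD b bbs.
  split; apply/negP; [move=> /H1 | move=> /H2] => -[cx _].
    have E : b = b1 by apply: cmp_D => //; apply: connect_trans cbx _; rewrite gc_connect_sym.
    by rewrite E (negbTE nb1) in bbs.
  have E : b = b2 by apply: cmp_D => //; apply: connect_trans cbx _; rewrite gc_connect_sym.
  by rewrite E (negbTE nb2) in bbs.
have q12 x : x \in b1 :: q1 -> x \notin b2 :: q2.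
  move=> /H1[cx _]; apply/negP => /H2[cx' _]; move: b12; apply/negP; rewrite negbK.
  by apply/eqP/cmp_D => //; apply: connect_trans cx _; rewrite gc_connect_sym.
have us : uniq s.
  rewrite /s cat_uniq uq1 /= rev_uniq uq2 andbT mem_rev negb_or.
  rewrite (_ : w \notin b1 :: q1) /=; last by apply/negP => /H1[_]; rewrite wT.
  rewrite (_ : w \notin b2 :: q2) ?andbT /=; last by apply/negP => /H2[_]; rewrite wT.
  by apply/hasPn => x; rewrite mem_rev => /(contraL (@q12 x)).
have g1sym := del_sym A gsym.
have ls : longseg s.
  rewrite /longseg /s size_cat /= size_rev /= !addnS ltnS ltnS ltnS andbT.
  have pq1 : path g1 b1 q1 := sq1; have /setDP[-> _] := b1D;
    rewrite cat_path /= pq1 lq1 g1sym gw1 /=.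
  have Er : rev (b2 :: q2) = v2 :: behead (rev (b2 :: q2)).
    by rewrite lastI rev_rcons lq2.
  have := sorted_rev_sym g1sym sq2; rewrite Er /= gw2 => ->.
  rewrite last_cat /= (_ : last v2 _ = b2) ?leq_addl; last first.
    by rewrite -[last v2 _]/(last w (v2 :: _)) -Er rev_cons last_rcons.
  by have /setDP[-> _] := b2D.
exists [:: b1, b2 & bs], (s :: ss); split.
- by rewrite /= inE negb_or b12 nb1 nb2 ubs.
- by move=> x; rewrite !in_cons => /or3P[/eqP->|/eqP->|/bsD].
- by rewrite /= szb mulnS.
- split; last by rewrite /= szs.
  have /andP[al un] := fam.
  apply/andP; split; first by rewrite /= ls al.
  rewrite -[flatten _]/(s ++ flatten ss) cat_uniq us un andbT andTb.
  apply/hasPn => x xf; have [n1 n2] := famT x xf.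
  rewrite /s mem_cat (negbTE n1) inE mem_rev (negbTE n2) orbF /=.
  case: (cov x xf) => [xws|[b bbs cbx]].
    by apply: contraNneq wws => <-.
  apply: contraTneq wT => <-.
  by have [] := cmp_notin (bsD b bbs) cbx.
move=> x; rewrite -[flatten _]/(s ++ flatten ss) mem_cat => /orP[|xf].
  rewrite /s mem_cat => /orP[/H1[cx _]|].
    by right; exists b1; rewrite // inE eqxx.
  rewrite inE => /orP[/eqP->|]; first by left; rewrite mem_head.
  by rewrite mem_rev => /H2[cx _]; right; exists b2; rewrite // !inE eqxx orbT.
case: (cov x xf) => [xws|[b bbs cbx]]; first by left; rewrite inE xws orbT.
by right; exists b; rewrite // !inE bbs !orbT.
Qed.

(** Otherwise h heavy vertices would give h disjoint long segments. *)
Lemma card_heavy : #|W| < h.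
Proof.
rewrite ltnNge; apply/negP => /choose_seq[ws [uws szw wsW]].
have [|bs [ss [_ _ _ [fam szs] _]]] := segs_through_heavy uws wsW; first by rewrite szw.
by apply: (no_segfamily fam); rewrite szs szw.
Qed.


(** Small components have at most two vertices and no neighbour among the non-heavy vertices of [T].
    Below, [NB] and [NZ] are their vertices inside and outside [D]; [LB] and [LZ] are the
    corresponding leftovers, apart from [A] and [T]. *)
Definition small : {set V} :=
  [set b in D | (#|cmp b| <= 2) && [forall w in T :\: W, b \notin touch w]].
Definition smallU : {set V} := [set v | [exists b in small, connect gc b v]].
Notation NB := small.
Notation N := smallU.
Notation NZ := (N :\: NB).
Notation LB := (D :\: NB).
Notation LZ := (~: (A :|: N :|: T :|: D)).

Lemma smallP b : b \in NB ->
  [/\ b \in D, #|cmp b| <= 2 & forall w, w \in T -> w \notin W -> b \notin touch w].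
Proof.
rewrite inE => /and3P[bD cb /forall_inP H]; split=> // w wT wW.
by apply: H; rewrite in_setD wT wW.
Qed.

Lemma smallUP v : reflect (exists2 b, b \in NB & connect gc b v) (v \in N).
Proof. by rewrite inE; apply: exists_inP. Qed.

Lemma small_subU : NB \subset N.
Proof. by apply/subsetP => b bN; apply/smallUP; exists b. Qed.

Lemma smallU_D v : v \in N -> v \in D -> v \in NB.
Proof.
by case/smallUP=> b bN cbv vD; have [bD _ _] := smallP bN; rewrite -(cmp_D bD vD cbv).
Qed.

Lemma smallU_notin v : v \in N -> v \notin A /\ v \notin T.
Proof. by case/smallUP=> b /smallP[bD _ _]; apply: cmp_notin. Qed.

(** Outside [T] the vertex y would belong to the component of x, and a non-heavy vertex of [T] does
    not touch a small component. *)
Lemma smallU_nbr x y : x \in N -> y \notin N -> nodd x y -> y \in W.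
Proof.
move=> xN yN nxy; have [_ xT] := smallU_notin xN.
have [b bN cbx] := smallUP _ xN; have [bD _ Hb] := smallP bN.
have yT : y \in T.
  apply: contraR yN => yT; apply/smallUP; exists b => //.
  by apply: connect_trans cbx _; apply: connect1; rewrite /del xT yT.
apply: contraT => yW; have := Hb y yT yW; rewrite [b \in _]inE bD /=; case/negP.
by apply/existsP; exists x; rewrite cbx (del_sym A gsym) nodd_sub.
Qed.

(** A small component carries at most one edge, joining its vertex in [D] to its only other
    vertex. *)
Lemma ed_smallU : ed nodd N N <= 2 * #|NZ|.
Proof.
rewrite (ed_split_sym NB N nodd_sym) (setIidPr small_subU).
rewrite (@ed_eq0 _ _ NB NB) => [|x y /smallP[xD _ _] /smallP[yD _ _]]; last first.
  by rewrite /nodd xD yD andbF.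
have gcN x y : x \in N -> y \in N -> nodd x y -> gc x y.
  by move=> /smallU_notin[_ xT] /smallU_notin[_ yT] nxy; rewrite /del xT yT.
rewrite (@ed_eq0 _ _ NZ NZ) ?addn0 => [|x y /setDP[xN xB] /setDP[yN yB]]; last first.
  apply/negP => nxy; have [b bN cbx] := smallUP _ xN; have [bD cb _] := smallP bN.
  have sub : [set b; x; y] \subset cmp b.
    apply/subsetP => z; rewrite !inE => /orP[/orP[]/eqP->|/eqP->] //.
    by apply: connect_trans cbx (connect1 _); apply: gcN.
  have := leq_trans (subset_leq_card sub) cb.
  rewrite -setUA cardsU1 cards2 !inE negb_or.
  have -> : b != x by apply: contraNneq xB => <-.
  have -> : b != y by apply: contraNneq yB => <-.
  suff -> : x != y by [].
  by apply: contraTneq nxy => ->; rewrite /nodd del_irr.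
rewrite add0n leq_mul2l /= (edC _ _ nodd_sym) -[leqRHS]muln1.
apply: ed_leq => z /setDP[zN _]; rewrite leqNgt; apply/negP => /card_gt1P[x [y []]].
rewrite ![_ \in nbrs _ _ _]inE => /andP[xN nzx] /andP[yN nzy]; case/eqP.
have [xD _ _] := smallP xN; have [yD _ _] := smallP yN; apply: cmp_D => //.
have sN := subsetP small_subU.
by apply: (connect_trans (y := z)); apply: connect1; apply: gcN; rewrite // ?sN // nodd_sym.
Qed.

Variable t : nat.
Hypothesis few : #|W| < h - 1 \/ #|cnbrs g (A :|: W)| <= t.

(** With fewer than h - 1 heavy vertices the bound is immediate. With h - 1 of them, all but t
    vertices of [NB] miss a heavy one, because as members of [B] they already see all of [A]. *)
Lemma ed_small_heavy : ed nodd NB W <= #|NB| * (h - 2) + t.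
Proof.
have hW := card_heavy.
have [lt|ge] := ltnP #|W| (h - 1).
  apply: leq_trans (leq_addr _ _); apply: leq_trans (ed_leq_mul _ _ _) _.
  by rewrite leq_mul2l; apply/orP; right; move: lt; clear; lia.
case: few => [lt|cW]; first by rewrite ltnNge ge in lt.
have EW : #|W| = h - 1 by move: hW ge; clear; lia.
pose C := cnbrs g (A :|: W).
rewrite (ed_splitl nodd C).
have e1 : ed nodd (NB :&: C) W <= #|NB :&: C| * (h - 1) by rewrite -EW ed_leq_mul.
have e2 : ed nodd (NB :\: C) W <= #|NB :\: C| * (h - 2).
  apply: ed_leq => b /setDP[/smallP[/setDP[bB _] _ _]].
  rewrite inE negb_forall_in => /exists_inP[w]; rewrite in_setU => /orP[wA|wW] gwb.
    by rewrite (cnbrsP _ _ _ bB) in gwb.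
  have -> : h - 2 = #|W :\ w| by move: EW; rewrite (cardsD1 w W) wW; move: #|_|; clear; lia.
  apply/subset_leq_card/subsetP => y; rewrite [_ \in nbrs _ _ _]inE => /andP[yW nby].
  rewrite in_setD1 yW andbT; apply: contraNneq gwb => <-.
  by rewrite gsym; apply: (@del_sub _ g A); apply: nodd_sub.
have e3 : #|NB :&: C| <= t by apply: leq_trans (subset_leq_card (subsetIr _ _)) cW.
have Eh : h - 1 = (h - 2) + 1 by move: h2; clear; lia.
apply: leq_trans (leq_add e1 e2) _; rewrite -(cardsID C NB) Eh mulnDr mulnDl muln1.
by move: e3; move: (_ * (h - 2)) (_ * (h - 2)) => x y; clear; lia.
Qed.

Lemma ed_smallU_out : ed nodd N (~: N) <= #|NB| * (h - 2) + t + #|NZ| * (h - 1).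
Proof.
rewrite (ed_splitr nodd W) (@ed_eq0 _ _ N (~: N :\: W)) ?addn0 => [|x y xN]; last first.
  move=> /setDP[]; rewrite inE => yN yW; apply: contra yW; exact: smallU_nbr.
apply: leq_trans (_ : ed nodd N W <= _).
  by apply: ed_mono => //; apply: subsetIr.
rewrite (ed_splitl nodd NB) (setIidPr small_subU); apply: leq_add; first exact: ed_small_heavy.
apply: ed_leq => x _; apply: leq_trans (nbrs_leq _ _ _) _.
by have := card_heavy; move: #|_|; clear; lia.
Qed.

(** A vertex of [LB] either has a component with at least two further vertices, all in [LZ] and not
    shared with another component, or is touched by one of the non-heavy vertices of [T], each of
    which touches fewer than 2h components. *)
Lemma card_large : 2 * #|LB| <= #|LZ| + 4 * h * #|T|.
Proof.
pose L1 := [set b in LB | 2 < #|cmp b|].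
pose L2 := \bigcup_(w in T :\: W) touch w.
have sub : LB \subset L1 :|: L2.
  apply/subsetP => b bL; have /setDP[bD bN] := bL.
  rewrite in_setU [_ \in L1]inE bL /=; have [//|cb] := ltnP 2 #|cmp b|.
  move: bN; rewrite inE bD cb /= negb_forall_in => /exists_inP[w wT]; rewrite negbK => bt.
  by apply/bigcupP; exists w.
have c2 : #|L2| <= 2 * h * #|T|.
  apply: leq_trans (_ : \sum_(w in T :\: W) #|touch w| <= _).
    rewrite /L2; elim/big_rec2: _ => [|w s X _ IH]; first by rewrite cards0.
    by apply: leq_trans (leq_card_setU _ _) _; rewrite leq_add2l.
  rewrite mulnC; apply: leq_trans (_ : #|T :\: W| * (2 * h) <= _); last first.
    by rewrite leq_mul2r subset_leq_card ?orbT // subsetDl.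
  rewrite -sum_nat_const; apply: leq_sum => w /setDP[wT wW].
  by move: wW; rewrite [w \in W]inE wT -ltnNge => /ltnW.
have c1 : #|L1| * 2 <= #|LZ| * 1.
  apply: leq_trans (_ : ed (connect gc) L1 LZ <= _).
    rewrite ed_nbrs -sum_nat_const; apply: leq_sum => b.
    rewrite [b \in L1]inE => /andP[/setDP[bD bN] cb].
    have /leq_trans-> // : 2 <= #|cmp b :\ b|.
      by move: cb; rewrite (cardsD1 b) inE connect0.
    apply/subset_leq_card/subsetP => v; rewrite in_setD1 inE => /andP[vb cbv].
    have [vA vT] := cmp_notin bD cbv; rewrite inE in_setC !in_setU cbv andbT.
    rewrite (negbTE vA) (negbTE vT) orbF /= negb_or; apply/andP; split; last first.
      by apply: contra vb => vD; rewrite (cmp_D bD vD cbv).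
    apply: contra bN => /smallUP[b' b'N cb'v]; have [b'D _ _] := smallP b'N.
    suff -> : b = b' by [].
    by apply: cmp_D => //; apply: connect_trans cbv _; rewrite gc_connect_sym.
  rewrite (edC _ _ gc_connect_sym); apply: ed_leq => v _.
  rewrite leqNgt; apply/negP => /card_gt1P[x [y []]].
  rewrite ![_ \in nbrs _ _ _]inE ![_ \in L1]inE.
  move=> /andP[/andP[/setDP[xD _] _] cvx] /andP[/andP[/setDP[yD _] _] cvy]; case/eqP.
  by apply: cmp_D => //; apply: connect_trans cvy; rewrite gc_connect_sym.
have c3 := leq_trans (subset_leq_card sub) (leq_card_setU _ _).
move: c1 c2 c3; rewrite -!mulnA; move: (h * _) #|LB| #|L1| #|L2| #|LZ|; clear; lia.
Qed.

(** The edges dropped in [nodd] form a matching inside [D]. *)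
Lemma ed_nodd : ed g1 setT setT <= ed nodd setT setT + #|D|.
Proof.
have g1sym := del_sym A gsym.
have e1 : ed g1 D D <= #|D| by rewrite -[leqRHS]muln1; apply: ed_leq => b; apply: nbrs_DD.
rewrite (ed_split_sym D setT g1sym) (ed_split_sym D setT nodd_sym) setTI setTD.
have e2 : ed g1 D (~: D) <= ed nodd D (~: D).
  apply: ed_mono_in => x y xD; rewrite in_setC => yD gxy.
  by rewrite /nodd gxy (negbTE yD) andbF.
have e3 : ed g1 (~: D) (~: D) <= ed nodd (~: D) (~: D).
  apply: ed_mono_in => x y; rewrite in_setC => xD _ gxy.
  by rewrite /nodd gxy (negbTE xD).
by move: e1 e2 e3; move: (ed _ _ _) (ed _ _ _) (ed _ _ _) (ed _ _ _) (ed _ _ _) (ed _ _ _);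
  clear; lia.
Qed.

(** Edges at [A] are counted by [ed_cnbrs], those at small components by their few possible ends,
    and all others at the Erdős-Gallai rate. Under [few] the total falls short of the density unless
    n is bounded by the error terms. *)
Lemma component_count c : (2 * (k * h) - 2) * #|V| <= ed g setT setT + c ->
  #|V| <= 7 * c + 8 * #|A| + 8 * #|T| + 8 * t + 6 * (4 * h * #|T|).
Proof.
move=> ge; have girr1 := del_irr A girr; have gsym1 := del_sym A gsym.
have EK : k * h = #|A| + h by rewrite cardA -mulSnr subn1 prednK // (leq_trans _ k2).
have cN : #|N| = #|NB| + #|NZ| by rewrite -(cardsID NB N) (setIidPr small_subU).
apply: (@component_arith h #|A| #|V| #|B| #|~: (A :|: B)| #|D| #|NB| #|NZ| #|~: N| #|T|
  #|LB| #|LZ| t c (ed g setT setT) (ed g1 setT setT) (ed nodd setT setT)) => //.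
- by rewrite cardA muln_gt0 subn_gt0 k2; move: h2; clear; lia.
- by rewrite card_cnbrs.
- by rewrite -cN cardsC.
- by rewrite -EK.
- exact: ed_cnbrs.
- exact: ed_nodd.
- rewrite -(cardsID NB D) (setIidPr _) //.
  by apply/subsetP => b /smallP[].
- rewrite (ed_split_sym N setT nodd_sym) setTI setTD.
  apply: leq_add; first apply: leq_add; first exact: ed_smallU.
    by rewrite leq_mul2l ed_smallU_out.
  apply: (path_free_ed h2 hl) => //; first exact: nodd_sym.
    by move=> x; rewrite /nodd girr1.
  by move=> hp; apply: noP1; apply: haspathsS hp; apply: nodd_sub.
- apply: leq_trans (_ : #|A :|: T :|: LB :|: LZ| <= _).
    apply/subset_leq_card/subsetP => v; rewrite in_setC => vN.
    rewrite !in_setU in_setD !in_setC !in_setU (negbTE vN).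
    have -> : v \notin NB by apply: contra vN; apply/subsetP/small_subU.
    by case: (v \in A); case: (v \in T); case: (v \in D).
  apply: leq_trans (leq_card_setU _ _) _; rewrite leq_add2r.
  apply: leq_trans (leq_card_setU _ _) _; rewrite leq_add2r.
  exact: leq_card_setU.
- have disj : NZ :&: LZ = set0.
    apply/setP => v; rewrite in_setI in_setD in_setC !in_setU in_set0.
    by case: (v \in N); rewrite ?orbT ?andbF.
  rewrite -[leqLHS]subn0 -(cards0 V) -disj -cardsU; apply/subset_leq_card/subsetP => v.
  rewrite in_setU => H; rewrite in_setC in_setU negb_or; move: H => /orP[/setDP[vN vB]|].
    have [vA vT] := smallU_notin vN; rewrite vA /=.
    by apply: contra vB => vB; apply: smallU_D => //; rewrite in_setD vT.
  by rewrite in_setC !in_setU in_setD !negb_or; case: (v \in A); case: (v \in T);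
    case: (v \in B);
    rewrite ?andbF.
- exact: card_large.
- rewrite -(cardsID T B) leq_add2r; apply/subset_leq_card/subsetIr.
- by rewrite -[#|V|]cardsT; apply: (path_free_ed h2 hl).
Qed.

End Components.
End Segments.

(** * Edges outside a large complete bipartite subgraph *)

(** Each of the Z vertices missing a vertex of [A] costs two ordered pairs, while the density leaves
    only n + c to spare. The substitutions are those of [component_arith]. *)
Lemma missing_arith h a n B Z c e e1 : 2 <= h -> 0 < a -> n = a + B + Z ->
  (2 * (a + h) - 2) * n <= e + c ->
  e <= a * a + 2 * (a * B + (a - 1) * Z) + e1 -> e1 <= (2 * h - 1) * n ->
  2 * Z <= c + n.
Proof.
move=> h2 a0 En H1 H2 H9.
have [h' Eh] : exists h', h = h' + 2 by exists (h - 2); rewrite subnK.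
have [a' Ea] : exists a', a = a' + 1 by exists (a - 1); rewrite subnK.
have E1 : a' * n = a' * a + a' * B + a' * Z by rewrite En !mulnDr.
subst a h.
have {}H1 : 2 * (a' * n) + 2 * (h' * n) + 4 * n <= e + c.
  apply: leq_trans H1; apply: eq_leq; clear.
  by rewrite (_ : _ - 2 = 2 * a' + 2 * h' + 4); lia.
have {}H2 : e <= a' * (a' + 1) + (a' + 1) + 2 * (a' * B) + 2 * B + 2 * (a' * Z) + e1.
  by apply: leq_trans H2 _; rewrite addnK; clear; lia.
have {}H9 : e1 <= 2 * (h' * n) + 3 * n.
  by apply: leq_trans H9 _; clear; rewrite (_ : _ - 1 = 2 * h' + 3); lia.
move: (a' * (a' + 1)) (a' * B) (a' * Z) (a' * n) (h' * n) E1 H1 H2 H9 => x1 x2 x3 x4 x5.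
by move: En; clear; lia.
Qed.

Section Structure.
Variable V : finType.
Implicit Types (S T X Y Z A B W : {set V}) (x y b v w : V).
Implicit Types (p q s xs : seq V) (ss : seq (seq V)).
Variables (g : rel V) (h l k : nat).
Hypotheses (gsym : symmetric g) (girr : irreflexive g).
Hypotheses (h2 : 2 <= h) (hl : 2 * h <= l <= 2 * h + 1) (k2 : 2 <= k).
Hypothesis noP : ~ haspaths g k l.
Notation n := #|V|.

(** The set sought is a deletable set of (k - 1)h vertices together with the heavy vertices. If
    there were fewer than h - 1 heavy vertices, or too few common neighbours, [component_count]
    would contradict the size of n. *)
Lemma large_common_nbhd c t :
  (2 * (k * h) - 2) * n <= ed g setT setT + c ->
  c + l ^ 2 + 2 * l * ('C(l, h) * (k * l)) < n ->
  2 * (k * l + h * l + 2) + 2 * (k * h) + c <= n ->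
  7 * c + 8 * (k * h) + 8 * (h * l) + 8 * t + 6 * (4 * h * (h * l)) < n ->
  exists A, #|A| = k * h - 1 /\ t < #|cnbrs g A|.
Proof.
move=> ge big1 big2 big3.
have EK : k * h = (k - 1) * h + h by rewrite -mulSnr subn1 prednK // (leq_trans _ k2).
have [A0 [cA0 noA0]] : exists A, #|A| <= (k - 1) * h /\ ~ haspaths (del g A) 1 l.
  by apply: (deletableP h2 hl big1) => //; rewrite leqnn andbT (leq_trans _ k2).
(* Padding [A0] with arbitrary vertices makes its size exact and creates no path. *)
have [A [cA noA]] : exists A, #|A| = (k - 1) * h /\ ~ haspaths (del g A) 1 l.
  have [|X [sX cX _]] := @split_set _ (~: A0) ((k - 1) * h - #|A0|).
    have := cardsC A0; move: big2; rewrite EK.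
    by move: #|V| #|~: _| #|A0| ((k - 1) * h) (k * l) (h * l); clear; lia.
  exists (A0 :|: X); split.
    rewrite cardsU cX (_ : A0 :&: X = set0) ?cards0 ?subn0 ?subnKC //.
    apply/setP => v; rewrite in_setI in_set0; apply/andP => -[vA /(subsetP sX)].
    by rewrite in_setC vA.
  by move=> hp; apply: noA0; apply: haspathsS hp; apply: delS; apply: subsetUl.
have a0 : 0 < #|A| by rewrite cA muln_gt0 subn_gt0 k2; move: h2; clear; lia.
have bigB : k * l + h * l + 2 <= #|cnbrs g A|.
  have := @missing_arith h #|A| n #|cnbrs g A| #|~: (A :|: cnbrs g A)| c
    (ed g setT setT) (ed (del g A) setT setT) h2 a0 (esym (card_cnbrs A girr gsym)).
  rewrite cA -EK -cA => /(_ ge (ed_cnbrs A girr gsym)).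
  have := path_free_ed h2 hl setT (del_sym A gsym) (del_irr A girr) noA.
  rewrite cardsT => e1 /(_ e1); have := card_cnbrs A girr gsym; move: big2; rewrite EK -cA.
  by move: #|V| #|~: _| #|cnbrs _ _| #|A| (k * l) (h * l); clear; lia.
have [ss [fam szs maxs]] := maximal_segfamily gsym girr h2 hl k2 cA noP noA bigB.
pose W := heavy g A h ss.
have cW : #|W| < h := card_heavy gsym girr h2 hl k2 cA noP noA bigB maxs.
have cT : #|hit ss| <= h * l := card_hit noA fam szs.
have AW : A :&: W = set0.
  apply/setP => v; rewrite in_setI in_set0; apply/andP => -[vA].
  rewrite inE => /andP[+ _]; rewrite inE => /flattenP[s sss vs].
  have /andP[/allP/(_ s sss)/andP[/seg_sorted sgs sz] _] := fam.
  by have := sorted_del_notin (ltnW sz) sgs vs; rewrite vA.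
case: (classic (#|W| < h - 1 \/ #|cnbrs g (A :|: W)| <= t)) => [few|many].
  have := component_count gsym girr h2 hl k2 cA noP noA bigB maxs few ge.
  have cAK : #|A| <= k * h by rewrite cA EK leq_addr.
  have cTh : h * #|hit ss| <= h * (h * l) by rewrite leq_mul2l cT orbT.
  rewrite -!(mulnA 4) => le; exfalso; move: le cAK cTh cT big3; rewrite -!(mulnA 4).
  by move: #|V| (h * l) (h * (h * l)) #|hit _| (h * #|hit _|) (k * h) #|A|; clear; lia.
exists (A :|: W); rewrite cardsU AW cards0 subn0.
have nW : ~~ (#|W| < h - 1) by apply/negP => lt; apply: many; left.
split; last by rewrite ltnNge; apply/negP => le; apply: many; right.
by rewrite cA EK; move: nW cW h2; clear; lia.
Qed.

(** * Edges outside [A] weighed against missing edges to [A] *)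

Section Core.
Variable A : {set V}.
Hypothesis cardA : #|A| = k * h - 1.
Hypothesis bigC : k * l + 4 < #|cnbrs g A|.
Notation C := (cnbrs g A).

Let kh2 : 2 * h <= k * h. Proof. by rewrite leq_mul2r k2 orbT. Qed.
Let EK : k * h = (k - 1) * h + h.
Proof. by rewrite -mulSnr subn1 prednK // (leq_trans _ k2). Qed.
Let hl' : [/\ 1 < l, l <= 2 * h + 1 & h < l].
Proof. by split; move: h2 hl; clear; lia. Qed.

(** The (k - 1)h vertices of [X] would yield k - 1 further disjoint paths through their common
    neighbours. *)
Lemma one_path_out X : X \subset A -> #|X| = (k - 1) * h -> ~ haspaths (del g X) 1 l.
Proof.
move=> XA cX hp; apply: noP.
have -> : k = (k - 1) + 1 by rewrite subnK // (leq_trans _ k2).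
have [? ? ?] := hl'.
apply: (extend_paths (X := X) (h := h)) => //.
rewrite subnK ?(leq_trans _ k2) //; apply: leq_trans (subset_leq_card (cnbrs_sub g XA)).
by apply: ltnW; apply: leq_trans bigC; rewrite ltnS leq_addr.
Qed.

Lemma no_path_out p : sorted g p -> uniq p -> (forall x, x \in p -> x \notin A) ->
  size p < l.
Proof.
move=> sp up pA; rewrite ltnNge; apply/negP => szp.
have [|X [XA cX _]] := @split_set _ A ((k - 1) * h).
  by rewrite cardA EK; move: h2; clear; lia.
apply: (one_path_out XA cX); apply: (haspaths1 (p := p)) => //.
have pX x : x \in p -> x \notin X by move=> /pA; apply: contra; apply/subsetP.
case: p sp {up szp pA} pX => //= x p; elim: p x => //= y p IHp x /andP[gxy pth] pX.
rewrite /del gxy !pX ?inE ?eqxx ?orbT //=; apply: IHp => // z zp.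
by apply: pX; rewrite inE zp orbT.
Qed.

(* A path q outside A whose last vertex sees A is continued by alternating
   between h - 1 vertices of A and their common neighbours. *)
Lemma short_tail q x a : sorted g (rcons q x) -> uniq (rcons q x) ->
  (forall y, y \in rcons q x -> y \notin A) -> a \in A -> g x a -> size q <= 3 ->
  size q + (2 * h - 1) < l.
Proof.
move=> sq uq qA aA gxa szq; rewrite ltnNge; apply/negP => szl.
have cAa : #|A :\ a| = k * h - 2 by move: cardA; rewrite (cardsD1 a) aA; move: #|_|; clear;
  lia.
(* Together with [a] the path uses h - 1 vertices of [A], which leaves exactly (k - 1)h for [X]. Its
   length is (|q| + 1) + (h - 1) + (h - 1) vertices. *)
have [|Y [YA cY cX]] := @split_set _ (A :\ a) (h - 2).
  by rewrite cAa; move: h2 kh2; clear; lia.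
have XA : (A :\ a) :\: Y \subset A.
  by apply: subset_trans (subsetDl _ _) _; apply: subsetDl.
set X := (A :\ a) :\: Y in cX XA.
have cX' : #|X| = (k - 1) * h by rewrite cX cAa; move: EK h2;
  move: ((k - 1) * h) (k * h) => z1 z2; clear; lia.
apply: (one_path_out XA cX').
have [|bs [ubs szb bsC]] := @choose_seq_out _ C (rcons q x) (h - 1).
  apply: leq_trans (ltnW bigC); rewrite size_rcons.
  have : h <= k * l by rewrite (leq_trans _ (leq_pmull l (ltnW k2))) //; move: hl; clear; lia.
  by move: szq; move: (k * l) (size _); clear; lia.
have bsA b : b \in bs -> b \notin A by move=> /bsC[/(cnbrs_notin girr)].
set g' := del g X; have g'sym : symmetric g' by apply: del_sym.
have XnA y : y \notin A -> y \notin X by apply: contra; apply/subsetP.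
have aX : a \notin X by rewrite !inE eqxx /= andbF.
have full y b : y \in enum Y -> b \in C -> g' y b.
  rewrite mem_enum => yY bC; have yA : y \in A.
    by move: (subsetP YA y yY); rewrite inE => /andP[].
  rewrite /g' /del (cnbrsP _ _ _ bC) // (XnA b) ?(cnbrs_notin girr bC) // andbT.
  by rewrite inE yY.
pose r := join (enum Y) [seq [:: b] | b <- bs].
have szr : size [seq [:: b] | b <- bs] = (size (enum Y)).+1.
  by rewrite size_map szb -cardE cY; move: h2; clear; lia.
have pr : perm_eq r (enum Y ++ bs).
  by rewrite -[in X in perm_eq _ X](flatten_seq1 bs) perm_join.
have sr : seg g' C r.
  apply: seg_join => //; apply/allP => _ /mapP[b /bsC[bC _] ->]; exact: seg1.
have sq' : sorted g' (rcons q x).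
  have qX z : z \in rcons q x -> z \notin X by move=> /qA/XnA.
  case: (rcons q x) sq qX => //= y p; elim: p y => //= z p IHp y /andP[gyz pth] pX.
  rewrite /g' /del gyz !pX ?inE ?eqxx ?orbT //=; apply: IHp => // u up.
  by apply: pX; rewrite inE up orbT.
have xA : x \notin A by apply: qA; rewrite mem_rcons mem_head.
have sar : sorted g' (a :: r).
  case: r sr {pr} => //= b r /and3P[-> bC _];
    rewrite andbT /g' /del aX XnA ?(cnbrs_notin girr bC) //=.
  exact: (cnbrsP _ _ _ bC).
apply: (haspaths1 (p := rcons q x ++ a :: r)).
- apply: (sorted_cat2 (x := x)) => // _ _; rewrite last_rcons /= /g' /del gxa aX andbT.
  by rewrite XnA.
- rewrite cat_uniq uq cons_uniq (perm_uniq pr) cat_uniq enum_uniq ubs andbT.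
  rewrite (perm_mem pr) mem_cat mem_enum negb_or.
  have -> : a \notin Y by apply: contraT; rewrite negbK => /(subsetP YA); rewrite !inE eqxx.
  have -> : a \notin bs by apply: contraT; rewrite negbK => /bsA; rewrite aA.
  have -> : ~~ has (mem (enum Y)) bs.
    apply/hasPn => b /bsA bA; rewrite /= mem_enum; apply: contra bA => /(subsetP YA).
    by rewrite inE => /andP[].
  rewrite !andbT; apply/hasPn => z; rewrite in_cons (perm_mem pr) mem_cat mem_enum => Hz.
  apply/negP => zq; have := qA z zq; case/orP: Hz => [/eqP->|/orP[]]; first by rewrite aA.
    by move=> /(subsetP YA); rewrite inE => /andP[_ ->].
  by move=> /bsC[_]; rewrite zq.
- rewrite size_cat size_rcons /= (perm_size pr) size_cat -cardE cY szb.
  by move: szl h2; move: (size q); clear; lia.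
Qed.

(* Two disjoint edges inside the common neighbourhood compensate for the
   missing k h-th vertex of A. *)
Lemma no_two_edges u v x y : u \in C -> v \in C -> x \in C -> y \in C ->
  g u v -> g x y -> ~ uniq [:: u; v; x; y].
Proof.
move=> uC vC xC yC guv gxy un.
(* The h - 1 links join h pieces, the two edges and h - 2 single vertices: 2h + 1 vertices in
   all. *)
have [|Y [YA cY cX]] := @split_set _ A (h - 1).
  by rewrite cardA; move: h2 kh2; clear; lia.
have XA : A :\: Y \subset A by apply: subsetDl.
set X := A :\: Y in cX XA.
have cX' : #|X| = (k - 1) * h by rewrite cX cardA; move: EK h2;
  move: ((k - 1) * h) (k * h) => z1 z2; clear; lia.
apply: (one_path_out XA cX').
have [|bs [ubs szb bsC]] := @choose_seq_out _ C [:: u; v; x; y] (h - 2).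
  apply: leq_trans (ltnW bigC); rewrite /= leq_add2r.
  have : h <= k * l by rewrite (leq_trans _ (leq_pmull l (ltnW k2))) //; move: hl; clear; lia.
  by clear; lia.
set g' := del g X; have g'sym : symmetric g' by apply: del_sym.
have CX b : b \in C -> b \notin X.
  by move=> /(cnbrs_notin girr); apply: contra; apply/subsetP.
have full a b : a \in enum Y -> b \in C -> g' a b.
  rewrite mem_enum => aY bC; have aA := subsetP YA a aY.
  by rewrite /g' /del (cnbrsP _ _ _ bC) // (CX b) // inE aY.
pose ss := [:: [:: u; v], [:: x; y] & [seq [:: b] | b <- bs]].
have szr : size ss = (size (enum Y)).+1.
  by rewrite /= size_map szb -cardE cY; move: h2; clear; lia.
have pr := perm_join szr.
have fss : flatten ss = [:: u; v; x; y] ++ bs by rewrite /= flatten_seq1.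
have sr : seg g' C (join (enum Y) ss).
  apply: seg_join => //; apply/allP => s; rewrite !in_cons => /or3P[/eqP->|/eqP->|].
  - by rewrite /= /g' /del guv uC vC !CX.
  - by rewrite /= /g' /del gxy xC yC !CX.
  - by move=> /mapP[b /bsC[bC _] ->]; exact: seg1.
apply: (haspaths1 (p := join (enum Y) ss)); first exact: seg_sorted sr.
- rewrite (perm_uniq pr) fss !cat_uniq enum_uniq un ubs andbT !andTb; apply/andP; split.
    apply/hasPn => b; rewrite mem_cat mem_enum => Hb.
    have bC : b \in C by case/orP: Hb => [|/bsC[]//];
      rewrite !in_cons => /or4P[/eqP->|/eqP->|/eqP->|]//; rewrite orbF => /eqP->.
    by apply: contra (cnbrs_notin girr bC); apply/subsetP.
  by apply/hasPn => b /bsC[].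
- rewrite (perm_size pr) size_cat fss size_cat -cardE cY szb /=.
  by move: hl h2; clear; lia.
Qed.

(** The number of non-adjacent pairs between [A] and its complement. *)
Definition missing : nat := \sum_(v in ~: A) (#|A| - #|nbrs g A v|).

Lemma ed_missing : ed g (~: A) A + missing = #|~: A| * #|A|.
Proof.
rewrite ed_nbrs /missing -big_split /= -sum_nat_const; apply: eq_bigr => v _.
by rewrite subnKC // nbrs_leq.
Qed.

Definition attached : {set V} := [set v in ~: A | [exists a in A, g v a]].
Notation R := (~: A).
Notation U := (R :\: attached).

Lemma attachedP v : reflect (v \notin A /\ exists2 a, a \in A & g v a) (v \in attached).
Proof.
rewrite inE in_setC; apply: (iffP andP) => -[vA].
  by move/exists_inP; split.
by move=> H; split=> //; apply/exists_inP.
Qed.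

Lemma unattached v : v \in U -> v \notin A.
Proof. by case/setDP; rewrite in_setC. Qed.

(** An unattached vertex misses all of [A]; an attached one that is not a common neighbour misses at
    least one vertex. *)
Lemma missing_geq : #|U| * #|A| + #|attached :\: C| <= missing.
Proof.
rewrite /missing (big_setID attached) /= addnC; apply: leq_add.
  rewrite (setIidPr _); last by apply/subsetP => v; rewrite inE => /andP[].
  rewrite (big_setID C) /= -sum1_card; apply: leq_trans (leq_addl _ _).
  apply: leq_sum => v /setDP[_]; rewrite inE negb_forall_in => /exists_inP[x xA gxv].
  rewrite subn_gt0 (cardsD1 x A) xA ltnS; apply/subset_leq_card/subsetP => y.
  rewrite !inE => /andP[-> gvy]; rewrite andbT.
  by apply: contraNneq gxv => <-; rewrite gsym.
rewrite -sum_nat_const; apply: leq_sum => v /setDP[vR]; rewrite inE vR /= => nv.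
rewrite (_ : nbrs g A v = set0) ?cards0 ?subn0 //; apply/setP => a; rewrite !inE.
by apply: contraNF nv => /andP[aA gva]; apply/exists_inP; exists a.
Qed.

(** Edges inside [U] obey Erdős-Gallai and are outweighed by the |A| missing edges at each vertex of
    [U]. For even l an attached vertex has no neighbour outside [A]. For odd l every vertex outside
    [A] has at most one attached neighbour, so the edges at [U] and at attached vertices outside [C]
    are paid for; an edge between attached vertices of [C] is the one possible excess. *)
Lemma ed_out : ed g R R <= 2 * missing \/
  [/\ odd l, exists u v, [/\ u \in C, v \in C & g u v] & ed g R R <= 2 * missing + 2].
Proof.
have eU : ed g U U <= (2 * h - 1) * #|U|.
  apply: erdos_gallai => // [|p sp up pU]; first by move: h2; clear; lia.
  have := @no_path_out p sp up (fun x xp => unattached (pU x xp)).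
  by move: hl; move: (size p); clear; lia.
have attR : attached \subset R by apply/subsetP => v /attachedP[]; rewrite in_setC.
have e0 := ed_split_sym attached R gsym; rewrite (setIidPr attR) in e0.
have mg := missing_geq.
have h4 : (2 * h - 1) * #|U| + 2 * #|U| <= 2 * (#|U| * #|A|).
  rewrite -mulnDl mulnCA mulnC leq_mul2l cardA; apply/orP; right.
  by move: kh2 h2; clear; lia.
have [lo|le] := boolP (odd l); last first.
  left; have ll : l <= 2 * h.
    case/andP: hl => _; rewrite leq_eqVlt => /orP[/eqP E|]; last by rewrite addn1.
    by move: le; rewrite E oddD oddM.
  have noatt u v : u \in attached -> v \in R -> ~~ g u v.
    move=> /attachedP[uA [a aA gua]]; rewrite in_setC => vA; apply/negP => guv.
    have := @short_tail [:: v] u a; rewrite /= gsym guv !inE andbT.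
    have -> : v != u by apply: contraTneq guv => ->; rewrite girr.
    have H y : (y \in [:: v; u]) -> y \notin A by rewrite !inE => /orP[]/eqP->.
    by move=> /(_ isT isT H aA gua isT); move: ll h2; clear; lia.
  rewrite e0 (@ed_eq0 _ _ attached attached) => [|u v ua va]; last first.
    by apply: noatt => //; apply: (subsetP attR).
  rewrite (@ed_eq0 _ _ attached U) => [|u v ua /setDP[vR _]]; last exact: noatt.
  by move: eU mg h4; move: #|attached :\: C| #|U| ((2 * h - 1) * #|U|) (#|U| * #|A|) missing
    (ed _ _ _); clear; lia.
(* A three-vertex path outside [A] ending at an attached vertex would extend by [short_tail] to 2h +
   1 vertices. *)
have noP3 u v w : u \in attached -> v \notin A -> w \notin A -> g u v -> g v w -> u = w.
  move=> /attachedP[uA [a aA gua]] vA wA guv gvw; apply/eqP; apply: contraT => uw.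
  have := @short_tail [:: w; v] u a; rewrite /= gsym gvw gsym guv !inE negb_or (eq_sym w u) uw.
  have -> : w != v by apply: contraTneq gvw => ->; rewrite girr.
  have -> : v != u by apply: contraTneq guv => ->; rewrite girr.
  have H y : (y \in [:: w; v; u]) -> y \notin A by rewrite !inE => /or3P[]/eqP->.
  by move=> /(_ isT isT H aA gua isT); move: hl h2; clear; lia.
have attA u : u \in attached -> u \notin A by case/attachedP.
have e1 : ed g attached U <= #|U|.
  rewrite (edC _ _ gsym) -[leqRHS]muln1; apply: ed_leq => w /unattached wA.
  rewrite leqNgt; apply/negP => /card_gt1P[x [y []]]; rewrite ![_ \in nbrs _ _ _]inE.
  move=> /andP[xa gwx] /andP[ya gwy] /eqP; apply; apply: (noP3 x w y) => //.
    exact: attA.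
  by rewrite gsym.
have n1 u : u \in attached -> #|nbrs g attached u| <= 1.
  move=> ua; rewrite leqNgt; apply/negP => /card_gt1P[x [y []]];
    rewrite ![_ \in nbrs _ _ _]inE.
  move=> /andP[xa gwx] /andP[ya gwy] /eqP; apply; apply: (noP3 x u y) => //; try exact: attA.
  by rewrite gsym.
have e2 := ed_split_sym C attached gsym.
set F := attached :&: C in e2; set M := attached :\: C in e2 mg.
have e3 : 2 * ed g F M + ed g M M <= 2 * #|M|.
  rewrite (edC _ _ gsym); apply: leq_trans (_ : 2 * (ed g M F + ed g M M) <= _).
    by rewrite mulnDr leq_add2l leq_pmull.
  rewrite leq_mul2l /= -[leqRHS]muln1 -(ed_splitr g C M attached);
    apply: ed_leq => u /setDP[ua _].
  exact: n1.
case: (classic (exists u v, [/\ u \in F, v \in F & g u v])) => [[u [v [uF vF guv]]]|noF];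
  last first.
  left; have e4 : ed g F F = 0.
    apply: ed_eq0 => x y xF yF; apply/negP => gxy; apply: noF; by exists x, y.
  move: e0 e1 e2 e3 e4 eU mg h4; move: #|U| #|M| ((2 * h - 1) * #|U|) (#|U| * #|A|) missing.
  move: (ed g R R) (ed g attached attached) (ed g attached U) (ed g U U) (ed g F F) (ed g F
    M) (ed g M M).
  by clear; lia.
right; split=> //.
  by exists u, v; split=> //; [case/setIP: uF | case/setIP: vF].
(* A second edge inside [F] is excluded by [no_two_edges] if disjoint from the first, and by [noP3]
   if it shares a vertex with it. *)
have e4 : ed g F F <= 2.
  rewrite (ed_splitl g [set u; v]) (@ed_eq0 _ _ (F :\: _)) ?addn0.
    apply: leq_trans (_ : #|F :&: [set u; v]| * 1 <= _).
      apply: ed_leq => x /setIP[/setIP[xa _] _]; apply: leq_trans (n1 x xa).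
      by apply/subset_leq_card/subsetP => y; rewrite !inE => /andP[/andP[-> _] ->].
    rewrite muln1; apply: leq_trans (subset_leq_card (subsetIr _ _)) _.
    by rewrite cards2; case: (u != v).
  move=> x y /setDP[xF xuv] yF; apply/negP => gxy.
  have /setIP[xa xC] := xF; have /setIP[ya yC] := yF.
  have /setIP[ua uC] := uF; have /setIP[va vC] := vF.
  move: xuv; rewrite !inE negb_or => /andP[xu xv].
  apply: (no_two_edges uC vC xC yC guv gxy).
  rewrite /= !inE !negb_or (eq_sym u x) xu (eq_sym v x) xv !andbT /=.
  have -> : x != y by apply: contraTneq gxy => ->; rewrite girr.
  have -> : u != v by apply: contraTneq guv => ->; rewrite girr.
  rewrite andbT /=; apply/andP; split.
    apply: contraNneq xv => uy; rewrite -uy in gxy; apply/eqP; apply: (noP3 x u v) => //.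
    - exact: attA.
    - exact: attA.
  apply: contraNneq xu => vy; rewrite -vy in gxy; apply/eqP; apply: (noP3 x v u) => //.
  - exact: attA.
  - exact: attA.
  - by rewrite gsym.
move: e0 e1 e2 e3 e4 eU mg h4; move: #|U| #|M| ((2 * h - 1) * #|U|) (#|U| * #|A|) missing.
move: (ed g R R) (ed g attached attached) (ed g attached U) (ed g U U) (ed g F F) (ed g F M)
  (ed g M M).
by clear; lia.
Qed.

End Core.
End Structure.

(** * Embedding the forbidden graph *)

Section Forbidden.
Variables (U : finType) (F : rel U).
Implicit Types (x y u v w : U).
Hypothesis simpleF : simple_graph F.
Hypothesis noiso : forall x, exists y, F x y.

Lemma simple_irr : irreflexive F. Proof. by move=> x; apply/negbTE; case: simpleF. Qed.
Lemma simple_sym : symmetric F. Proof. by case: simpleF. Qed.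

Lemma edgesP (e : {set U}) : reflect (exists x y, F x y /\ e = [set x; y]) (e \in edges F).
Proof.
rewrite inE; apply: (iffP existsP) => [[x /existsP[y /andP[Fxy /eqP->]]]|[x [y [Fxy ->]]]].
  by exists x, y.
by exists x; apply/existsP; exists y; rewrite Fxy eqxx.
Qed.

Definition control u v := F u v /\ forall x y, F x y -> (x \in [set u; v]) || (y \in [set u;
  v]).

Lemma edge_control_control u v : F u v -> edge_control F [set [set u; v]] -> control u v.
Proof.
move=> Fuv /andP[_ /forall_inP H]; split=> // x y Fxy.
have exy : [set x; y] \in edges F by apply/edgesP; exists x, y.
have := H _ exy; rewrite inE; have [<- _|_ /= /exists_inP[e]] := eqVneq [set x; y] [set u; v].
  by rewrite !inE eqxx.
rewrite inE => /eqP-> /set0Pn[z]; rewrite in_setI in_set2 => /andP[/orP[/eqP->|/eqP->] ->] //.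
by rewrite orbT.
Qed.

Lemma control_edge_control u v : control u v -> edge_control F [set [set u; v]].
Proof.
case=> Fuv H; apply/andP; split.
  by rewrite sub1set; apply/edgesP; exists u, v.
apply/forall_inP => e /edgesP[x [y [Fxy ->]]]; apply/implyP => _.
apply/exists_inP; exists [set u; v]; rewrite ?inE //; apply/set0Pn.
case/orP: (H x y Fxy) => ?; [exists x | exists y]; rewrite in_setI in_set2 eqxx ?orbT //.
Qed.

Lemma controlC u v : control u v -> control v u.
Proof. by case=> Fuv H; split; [rewrite simple_sym | rewrite setUC]. Qed.

Lemma control_exists (x0 : U) : beta1 F = 1 -> exists u v, control u v.
Proof.
move=> b1; have [y0 Fxy0] := noiso x0.
have e0 : 0 < #|edges F|.
  by apply/card_gt0P; exists [set x0; y0]; apply/edgesP; exists x0, y0.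
(* [find] returns a position in [iota]. One edge suffices for position 1 to be in range, and there
   it equals the value 1. *)
have hasP : has (fun m => [exists S : {set {set U}}, edge_control F S && (#|S| == m)])
    (iota 0 (#|edges F|).+1).
  by rewrite has_find -/(beta1 F) b1 size_iota.
have := nth_find 0 hasP;
  rewrite -/(beta1 F) b1 nth_iota // => /existsP[S /andP[ec /cards1P[e Se]]].
move: (ec); rewrite Se => /andP[]; rewrite sub1set => /edgesP[u [v [Fuv Ee]]] _.
by exists u, v; apply: edge_control_control => //; rewrite -Ee -Se.
Qed.

Lemma chi_not2 : 3 <= chi F -> ~~ colorable F 2.
Proof.
move=> chi3; have := before_find 0 (chi3 : 2 < find _ _); rewrite nth_iota; first by move->.
by apply: leq_trans chi3 _; rewrite /chi; apply: leq_trans (find_size _ _) _;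
  rewrite size_iota.
Qed.

(** If [u] and [v] had no common neighbour, giving one colour to the neighbours of [u], among them
    [v], and the other to the rest would be a proper 2-colouring, as every edge meets {u, v}. *)
Lemma control_triangle u v : 3 <= chi F -> control u v -> exists w, F u w /\ F v w.
Proof.
move=> /chi_not2 nc [Fuv H]; apply: NNPP => notri; move/negP: nc; apply.
pose c := [ffun x : U =>
  if (x == u) || ((x != v) && ~~ F u x) then (ord0 : 'I_2) else ord_max].
apply/existsP; exists c; apply/forallP => x; apply/forallP => y; apply/implyP.
have uv : u != v by apply: contraTneq Fuv => ->; rewrite simple_irr.
have key a b : F a b -> a \in [set u; v] -> c a != c b.
  move=> Fab; rewrite in_set2 => /orP[]/eqP Ea; subst a; rewrite !ffunE eqxx /=.
    rewrite Fab /= andbF orbF; have [Eb|//] := eqVneq b u; by rewrite Eb simple_irr in Fab.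
  rewrite (eq_sym v u) (negbTE uv) /=; have [->//|bu] := eqVneq b u.
  have [Eb|bv] := eqVneq b v; first by rewrite Eb simple_irr in Fab.
  by have [Fub|] := boolP (F u b) => //=; case: notri; exists b.
move=> Fxy; case/orP: (H x y Fxy) => hx; first exact: key.
by rewrite eq_sym; apply: key => //; rewrite simple_sym.
Qed.

Lemma control_nbr u v x : control u v -> x \notin [set u; v] -> F u x || F v x.
Proof.
move=> [_ H] nx; have [y Fxy] := noiso x; have := H x y Fxy; rewrite (negbTE nx) /= in_set2.
by rewrite simple_sym in Fxy; case/orP=> /eqP E; rewrite -E Fxy ?orbT.
Qed.

Lemma triangleP (S : {set U}) :
  reflect (exists x y z, [/\ F x y, F y z, F x z & S = [set x; y; z]])
    ((#|S| == 3) && [forall x in S, forall y in S, (x != y) ==> F x y]).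
Proof.
apply: (iffP andP) => [[S3 +]|[x [y [z [Fxy Fyz Fxz ->]]]]].
  have /card_gt0P[x xS] : 0 < #|S| by rewrite (eqP S3).
  have /cards2P[y [z [yz E]]] : #|S :\ x| == 2 by rewrite (cardsD1 x S) xS in S3.
  have ES : S = [set x; y; z] by rewrite -(setD1K xS) E setUA.
  have [xy xz] : x != y /\ x != z.
    by have := setD11 x S; rewrite E in_set2 => /negbT; rewrite negb_or => /andP[].
  rewrite ES => {xS S3 E ES} /forall_inP H; have H' a b : a \in [set x; y;
    z] -> b \in [set x; y; z] -> a != b -> F a b.
    by move=> aS bS ab; have /forall_inP/(_ b bS) := H a aS; rewrite ab.
  by exists x, y, z; split=> //; apply: H'; rewrite // !inE eqxx ?orbT.
have nF a b : F a b -> a != b by apply: contraTneq => ->; rewrite simple_irr.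
split; first by rewrite -setUA cardsU1 cards2 !inE negb_or !nF.
apply/forall_inP => a aS; apply/forall_inP => b bS; apply/implyP.
move: aS bS; rewrite !inE => /orP[/orP[]|]/eqP-> /orP[/orP[]|]/eqP->;
  by rewrite ?eqxx // => _; rewrite // simple_sym.
Qed.

Lemma ntriangles1 u v w w' : F u v -> ntriangles F = 1 -> F u w -> F v w -> F u w' -> F v w' ->
  w = w'.
Proof.
move=> Fuv /eqP/cards1P[S0 ES] Fuw Fvw Fuw' Fvw'.
have H z : F u z -> F v z -> [set u; v; z] = S0.
  move=> Fuz Fvz; apply/set1P; rewrite -ES inE; apply/triangleP.
  by exists u, v, z.
have : w \in [set u; v; w'] by rewrite H // -(H w) // !inE eqxx ?orbT.
rewrite !inE -orbA => /or3P[]/eqP // E; first by rewrite E simple_irr in Fuw.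
by rewrite E simple_irr in Fvw.
Qed.

(** Every edge meets {u, v}, so every triangle contains both [u] and [v], and its third vertex is a
    common neighbour. *)
Lemma control_ntriangles u v w : control u v -> F u w -> F v w ->
  (forall w', F u w' -> F v w' -> w' = w) -> ntriangles F = 1.
Proof.
move=> [Fuv H] Fuw Fvw uniqw.
apply/eqP/cards1P; exists [set u; v; w]; apply/setP => S; rewrite !inE.
apply/triangleP/eqP => [[x [y [z [Fxy Fyz Fxz ->]]]]|->]; last first.
  by exists u, v, w.
have uv : u != v by apply: contraTneq Fuv => ->; rewrite simple_irr.
have key a b c : F a b -> F b c -> F a c -> a \in [set u; v] -> b \in [set u; v] ->
    [set u; v; w] = [set a; b; c].
  move=> Fab Fbc Fac; rewrite !in_set2 => /orP[]/eqP Ea /orP[]/eqP Eb; subst a b.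
  - by rewrite simple_irr in Fab.
  - by rewrite (uniqw c).
  - by rewrite (uniqw c) // (setUC [set v]).
  - by rewrite simple_irr in Fab.
have Fyx : F y x by rewrite simple_sym.
have Fzx : F z x by rewrite simple_sym.
have Fzy : F z y by rewrite simple_sym.
have := H x y Fxy; have := H y z Fyz; have := H x z Fxz.
case xS: (x \in _); case yS: (y \in _); case zS: (z \in _) => // _ _ _.
- by rewrite (key x y z).
- by rewrite (key x y z).
- by rewrite (key x z y) // setUAC.
- by rewrite (key y z x) // -setUA setUC.
Qed.

(** * Embeddings of F and obstructions to them *)

Section Embed.
Variables (W : finType) (g : rel W).
Hypothesis gsym : symmetric g.

Lemma inj_into (S : {set U}) (T : {set W}) (w0 : W) : #|S| <= #|T| ->
  exists f : U -> W, {in S &, injective f} /\ forall x, x \in S -> f x \in T.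
Proof.
move=> ST; have lt x : x \in S -> index x (enum S) < size (enum T).
  by move=> xS; rewrite -cardE; apply: leq_trans ST; rewrite cardE index_mem mem_enum.
exists (fun x => nth w0 (enum T) (index x (enum S))); split=> [x y xS yS /eqP|x xS].
  rewrite nth_uniq ?enum_uniq ?lt // => /eqP E.
  by rewrite -(nth_index x (_ : x \in enum S)) ?mem_enum // E nth_index ?mem_enum.
by rewrite -mem_enum mem_nth ?lt.
Qed.

Lemma embedP (f : U -> W) : injective f -> (forall x y, F x y -> g (f x) (f y)) ->
  contains g F.
Proof.
move=> fi fF; apply/existsP; exists [ffun x => f x]; apply/andP; split.
  by apply/injectiveP => x y; rewrite !ffunE => /fi.
by apply/forallP => x; apply/forallP => y; rewrite !ffunE; apply/implyP => /fF.
Qed.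

Lemma containsP : contains g F -> exists f : U -> W,
  injective f /\ forall x y, F x y -> g (f x) (f y).
Proof.
case/existsP=> f /andP[/injectiveP fi /forallP fF]; exists f; split=> // x y.
by move: (fF x) => /forallP/(_ y)/implyP.
Qed.

(** The control edge goes to [a b]. The other vertices are pairwise non-adjacent, so any injection
    into common neighbours of [a] and [b] works. *)
Lemma embed_edge u v (a b : W) (T : {set W}) : control u v -> g a b -> a != b ->
  (forall t, t \in T -> [/\ t != a, t != b, g a t & g b t]) -> #|U| - 2 <= #|T| ->
  contains g F.
Proof.
move=> [Fuv H] gab ab HT cT.
have uv : u != v by apply: contraTneq Fuv => ->; rewrite simple_irr.
have [|p [pi pT]] := @inj_into (~: [set u; v]) T a.
  by apply: leq_trans cT; have := cardsC [set u; v]; rewrite cards2 uv; move: #|_|; clear; lia.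
pose f x := if x == u then a else if x == v then b else p x.
have pC x : x != u -> x != v -> x \in ~: [set u; v] by rewrite !inE negb_or => -> ->.
apply: (@embedP f).
  move=> x y; rewrite /f.
  have [->|xu] := eqVneq x u; have [->|yu] := eqVneq y u => //.
  - have [->|yv] := eqVneq y v; first by move=> E; rewrite E eqxx in ab.
    by move=> E; have [] := HT _ (pT y (pC y yu yv)); rewrite -E eqxx.
  - have [->|yv] := eqVneq x v; first by move=> E; rewrite E eqxx in ab.
    by move=> E; have [] := HT _ (pT x (pC x xu yv)); rewrite E eqxx.
  have [->|xv] := eqVneq x v; have [->|yv] := eqVneq y v => //.
  - by move=> E; have [_] := HT _ (pT y (pC y yu yv)); rewrite -E eqxx.
  - by move=> E; have [_] := HT _ (pT x (pC x xu xv)); rewrite E eqxx.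
  by apply: pi; apply: pC.
have key x y : F x y -> x \in [set u; v] -> g (f x) (f y).
  move=> Fxy; rewrite in_set2 => /orP[]/eqP E; subst x; rewrite /f eqxx.
    have [E|yu] := eqVneq y u; first by rewrite E simple_irr in Fxy.
    by have [//|yv] := eqVneq y v; have [] := HT _ (pT y (pC y yu yv)).
  rewrite (eq_sym v u) (negbTE uv); have [_|yu] := eqVneq y u; first by rewrite gsym.
  have [E|yv] := eqVneq y v; first by rewrite E simple_irr in Fxy.
  by have [] := HT _ (pT y (pC y yu yv)).
move=> x y Fxy; case/orP: (H x y Fxy) => hx; first exact: key.
by rewrite gsym; apply: key => //; rewrite simple_sym.
Qed.

(* The triangle u v w is mapped with u w onto the edge a b and v into A, so that
   the other neighbours of u go to A and those of v to C. *)
Lemma embed_pendant u v w (a b : W) (A C : {set W}) : control u v -> F u w -> F v w ->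
  (forall w', F u w' -> F v w' -> w' = w) -> a \in C -> b \in C -> g a b -> a != b ->
  (forall s t : W, s \in A -> t \in C -> g s t) -> [disjoint A & C] ->
  deg F u <= #|A| + 1 -> 0 < #|A| -> #|U| + 2 <= #|C| -> contains g F.
Proof.
move=> [Fuv H] Fuw Fvw uniqw aC bC gab ab full dis du /card_gt0P[a0 a0A] cC.
have nF x y : F x y -> x != y by apply: contraTneq => ->; rewrite simple_irr.
have uv := nF _ _ Fuv; have uw := nF _ _ Fuw; have vw := nF _ _ Fvw.
pose S1 := [set x | F u x] :\: [set v; w].
have [|p [pi pT]] := @inj_into S1 (A :\ a0) a.
  have : [set v; w] \subset [set x | F u x].
    by apply/subsetP => x; rewrite in_set2 inE => /orP[]/eqP->.
  move=> /setIidPr E; have := cardsID [set v; w] [set x | F u x]; rewrite E cards2 vw.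
  by move: du; rewrite /deg (cardsD1 a0 A) a0A -/S1; move: #|S1| #|_|; clear; lia.
have [|q [qi qT]] := @inj_into setT (C :\: [set a; b]) a.
  have := cardsID [set a; b] C; rewrite (setIidPr _) ?cards2 ?ab ?cardsT; last first.
    by apply/subsetP => x; rewrite in_set2 => /orP[]/eqP->.
  by move: cC; move: #|_| #|C| #|_|; clear; lia.
have AC (s : W) : s \in A -> s \notin C by move=> sA; rewrite (disjointFr dis sA).
pose f x := if x == u then a else if x == w then b else if x == v then a0
  else if F u x then p x else q x.
(* [kap] numbers the five cases defining [f], and [kap'] recovers the number from the image;
   injectivity then has to be checked only within each case. *)
pose kap x := if x == u then 0 else if x == w then 1 else if x == v then 2
  else if F u x then 3 else 4.
pose kap' (y : W) := if y == a then 0 else if y == b then 1 else if y == a0 then 2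
  else if y \in A then 3 else 4.
have aA : a \notin A by apply: contraL aC; apply: AC.
have bA : b \notin A by apply: contraL bC; apply: AC.
have pP x : x != w -> x != v -> F u x -> p x \in A /\ p x != a0.
  by move=> xw xv Fux; have := pT x; rewrite !inE negb_or xw xv Fux => /(_ isT)/andP[].
have qP x : [/\ q x \in C, q x != a & q x != b].
  by have := qT x; rewrite !inE negb_or => /(_ isT)/andP[/andP[]].
have kf x : kap' (f x) = kap x.
  rewrite /kap /f; have [_|xu] := eqVneq x u; first by rewrite /kap' eqxx.
  have [_|xw] := eqVneq x w; first by rewrite /kap' eq_sym (negbTE ab) eqxx.
  have [_|xv] := eqVneq x v.
    rewrite /kap' eqxx; have [E|_] := eqVneq a0 a; first by rewrite -E a0A in aA.
    by have [E|_] := eqVneq a0 b; first by rewrite -E a0A in bA.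
  have [Fux|nFux] := boolP (F u x).
    have [pA pa] := pP x xw xv Fux; rewrite /kap' pA (negbTE pa).
    have [E|_] := eqVneq (p x) a; first by rewrite -E pA in aA.
    by have [E|_] := eqVneq (p x) b; first by rewrite -E pA in bA.
  have [qC qa qb] := qP x; rewrite /kap' (negbTE qa) (negbTE qb).
  have -> : (q x \in A) = false by apply/negP => /AC; rewrite qC.
  by have [E|//] := eqVneq (q x) a0; move: (AC _ a0A); rewrite -E qC.
apply: (@embedP f).
  move=> x y E; have Ek : kap x = kap y by rewrite -!kf E.
  move: Ek E; rewrite /kap /f.
  have [->|xu] := eqVneq x u; have [->|yu] := eqVneq y u => //.
  - by case: ifP => // _; case: ifP => // _; case: ifP.
  - by case: ifP => // _; case: ifP => // _; case: ifP.
  have [->|xw] := eqVneq x w; have [->|yw] := eqVneq y w => //.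
  - by case: ifP => // _; case: ifP.
  - by case: ifP => // _; case: ifP.
  have [->|xv] := eqVneq x v; have [->|yv] := eqVneq y v => //.
  - by case: ifP.
  - by case: ifP.
  case Fux: (F u x); case Fuy: (F u y) => // _; last by apply: qi; rewrite inE.
  by apply: pi; rewrite !inE negb_or ?xv ?xw ?Fux // yv yw Fuy.
have key x y : F x y -> x \in [set u; v] -> g (f x) (f y).
  move=> Fxy; rewrite in_set2 => /orP[]/eqP E; subst x; rewrite /f eqxx.
    have [E|yu] := eqVneq y u; first by rewrite E simple_irr in Fxy.
    have [//|yw] := eqVneq y w.
    have [_|yv] := eqVneq y v; first by rewrite gsym full.
    by rewrite Fxy gsym full //; case: (pP y yw yv Fxy).
  rewrite (eq_sym v u) (negbTE uv) (negbTE vw); have [_|yu] := eqVneq y u;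
    first by rewrite full.
  have [_|yw] := eqVneq y w; first by rewrite full.
  have [E|yv] := eqVneq y v; first by rewrite E simple_irr in Fxy.
  case: ifP => [Fuy|_]; first by move: yw; rewrite (uniqw y) ?eqxx.
  by rewrite full //; case: (qP y).
move=> x y Fxy; case/orP: (H x y Fxy) => hx; first exact: key.
by rewrite gsym; apply: key => //; rewrite simple_sym.
Qed.

Lemma bipartite_free (A : {set W}) : 3 <= chi F ->
  (forall s t : W, g s t -> (s \in A) != (t \in A)) -> ~~ contains g F.
Proof.
move=> /chi_not2 nc bip; apply: contra nc => /containsP[f [_ fF]].
apply/existsP; exists [ffun x => if f x \in A then (ord0 : 'I_2) else ord_max].
apply/forallP => x; apply/forallP => y; apply/implyP => /fF/bip; rewrite !ffunE.
by case: (f x \in A); case: (f y \in A).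
Qed.

(** If both ends of the control edge leave [A], they occupy a and b and all other vertices go into
    [A]. Otherwise one end lies in [A]; the other end x and the triangle's third vertex w occupy a
    and b, and all other neighbours of x go into [A], which bounds its degree and leaves only one
    triangle. *)
Lemma bipartite_plus_edge_free (A : {set W}) (a b : W) :
  3 <= chi F -> beta1 F = 1 -> 0 < #|U| ->
  a \notin A -> b \notin A ->
  (forall s t : W, g s t -> [\/ (s \in A) != (t \in A), s = a /\ t = b | s = b /\ t = a]) ->
  contains g F -> #|U| <= #|A| + 2 \/
  ntriangles F = 1 /\ exists u v, control u v /\ deg F u <= #|A| + 1.
Proof.
move=> chi3 b1 /card_gt0P[x0 _] aA bA bip /containsP[f [fi fF]].
have [u [v cuv]] := control_exists x0 b1.
have [w [Fuw Fvw]] := control_triangle chi3 cuv.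
have [Fuv H] := cuv.
have nF x y : F x y -> x != y by apply: contraTneq => ->; rewrite simple_irr.
have both x y : F x y -> f x \notin A -> f y \notin A ->
    f x \in [set a; b] /\ f y \in [set a; b].
  move=> /fF/bip[]; first by move=> ne /negbTE fx /negbTE fy; rewrite fx fy in ne.
    by case=> -> ->; rewrite !in_set2 !eqxx orbT.
  by case=> -> ->; rewrite !in_set2 !eqxx orbT.
have nA x y : F x y -> f x \in A -> f y \notin A.
  move=> /fF/bip[]; first by case: (f x \in A); case: (f y \in A).
    by case=> ->; rewrite (negbTE aA).
  by case=> ->; rewrite (negbTE bA).
(* Otherwise three distinct vertices would be mapped injectively into {a, b}. *)
have third x y z : F x y -> f x \notin A -> f y \notin A -> z != x -> z != y ->
    F x z -> f z \in A.
  move=> Fxy fx fy zx zy Fxz; apply: contraT => fz.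
  have [h1 h2] := both _ _ Fxy fx fy; have [_ h3] := both _ _ Fxz fx fz.
  have xy := nF _ _ Fxy; have : #|f @: [set x; y; z]| <= #|[set a; b]|.
    apply/subset_leq_card/subsetP => _ /imsetP[t + ->]; rewrite !inE -orbA.
    by case/or3P=> /eqP->; [move: h1|move: h2|move: h3]; rewrite !inE.
  rewrite card_imset // -setUA cardsU1 cards2 !inE negb_or xy (eq_sym x) zx (eq_sym y) zy
    cards2.
  by case: (a != b).
have main x y : control x y -> F x w -> F y w -> f x \notin A -> f y \in A ->
    ntriangles F = 1 /\ exists u v, control u v /\ deg F u <= #|A| + 1.
  move=> cxy Fxw Fyw fx fy; have [Fxy _] := cxy; have fw := nA y w Fyw fy.
  have nbrx z : F x z -> z != w -> f z \in A.
    by move=> Fxz zw; apply: (third x w z) => //; rewrite eq_sym nF.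
  split.
    apply: (@control_ntriangles x y w) => // w' Fxw' Fyw'; apply/eqP; apply: contraT => ww.
    by have := nbrx w' Fxw' ww; rewrite (negbTE (nA y w' Fyw' fy)).
  exists x, y; split=> //; rewrite /deg (cardsD1 w) inE Fxw addnC leq_add2r.
  rewrite -(card_imset _ fi); apply/subset_leq_card/subsetP => _ /imsetP[z + ->].
  by rewrite !inE => /andP[zw Fxz]; apply: nbrx.
have [fu|fu] := boolP (f u \in A).
  right; apply: (main v u) => //; first exact: controlC.
  by apply: nA fu.
have [fv|fv] := boolP (f v \in A); first by right; apply: (main u v).
left; have uv := nF _ _ Fuv.
have sub : f @: (~: [set u; v]) \subset A.
  apply/subsetP => _ /imsetP[z + ->]; rewrite in_setC => zuv.
  move: (zuv); rewrite in_set2 negb_or => /andP[zu zv].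
  case/orP: (control_nbr cuv zuv) => Fz; first exact: (third u v z).
  by apply: (third v u z) => //; rewrite simple_sym.
have := subset_leq_card sub; rewrite card_imset //.
by have := cardsC [set u; v]; rewrite cards2 uv; move: #|_| #|A|; clear; lia.
Qed.

End Embed.
End Forbidden.

(** * Linear forests as subgraphs *)

Section KPath.
Variables (V : finType) (g : rel V).
Hypothesis gsym : symmetric g.
Implicit Types (x y : V) (p : seq V) (ps : seq (seq V)) (A : {set V}).

Lemma uniq_flatten_nth ps i j x : uniq (flatten ps) ->
  x \in nth [::] ps i -> x \in nth [::] ps j -> i = j.
Proof.
have mem_nth_flatten ps' m : x \in nth [::] ps' m -> x \in flatten ps'.
  move=> xm; apply/flattenP; exists (nth [::] ps' m) => //; apply: mem_nth.
  by rewrite ltnNge; apply/negP => H; rewrite nth_default in xm.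
elim: ps i j => [|p ps IHps] [|i] [|j] //=; rewrite cat_uniq => /and3P[_ /hasPn H un].
- by move=> xp /mem_nth_flatten/H; rewrite /= xp.
- by move=> /mem_nth_flatten/H /= /negbTE->.
- by move=> xi xj; rewrite (IHps i j).
Qed.

Lemma haspaths_kPath k l (x0 : V) : haspaths g k l -> contains g (@kPath k l).
Proof.
move=> [ps [sz /allP al un]].
have nthP (i : 'I_k) : sorted g (nth [::] ps i) /\ size (nth [::] ps i) = l.
  by have /al/andP[-> /eqP] : nth [::] ps i \in ps by rewrite mem_nth ?sz.
pose f (q : 'I_k * 'I_l) := nth x0 (nth [::] ps q.1) q.2.
have step (i : 'I_k) (a b : 'I_l) : a.+1 = b -> g (f (i, a)) (f (i, b)).
  move=> ab; have [srt szi] := nthP i; rewrite /f /= -ab.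
  by have /(sortedP x0) := srt; apply; rewrite ab szi.
apply: (@embedP _ _ _ _ f) => [[i a] [j b] E|[i a] [j b] /andP[/= /eqP <-]]; last first.
  case/orP=> /eqP ab; first exact: step.
  by rewrite gsym; apply: step.
have [_ szi] := nthP i; have [_ szj] := nthP j.
have Eij : i = j.
  apply/val_inj/(uniq_flatten_nth un (x := f (i, a))); first by rewrite mem_nth ?szi.
  by rewrite E mem_nth ?szj.
subst j; congr pair; apply/val_inj/eqP.
have un_i : uniq (nth [::] ps i) by apply: (uniq_flatten_mem un); rewrite mem_nth ?sz.
by rewrite -(nth_uniq x0 _ _ un_i) ?szi ?ltn_ord //; apply/eqP.
Qed.

Lemma kPath_haspaths k l : contains g (@kPath k l) -> haspaths g k l.
Proof.
move=> /containsP[f [fi fg]].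
exists [seq [seq f (i, j) | j <- enum 'I_l] | i <- enum 'I_k]; split.
- by rewrite size_map -cardE card_ord.
- apply/allP => _ /mapP[i _ ->]; rewrite size_map -cardE card_ord eqxx andbT.
  case: l f fi fg => [|l] f fi fg;
    first by rewrite (size0nil (s := enum _)) // -cardE card_ord.
  apply/(sortedP (f (i, ord0))) => m; rewrite size_map -cardE card_ord => ml.
  have nthE j : j < l.+1 -> exists2 j' : 'I_l.+1, j' = j :> nat &
      nth (f (i, ord0)) [seq f (i, j) | j <- enum 'I_l.+1] j = f (i, j').
    move=> jl; exists (nth ord0 (enum 'I_l.+1) j); first exact: nth_enum_ord.
    by rewrite (nth_map ord0) // -cardE card_ord.
  have [a ea ->] := nthE m (ltnW ml); have [b eb ->] := nthE m.+1 ml.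
  by apply: fg; rewrite /kPath /= eqxx ea eb eqxx.
- apply: (@allpairs_uniq _ _ _ (fun i j => f (i, j))); rewrite ?enum_uniq //.
  by move=> [a b] [c d] _ _ /= /fi.
Qed.

(** No two consecutive vertices avoid [A], so those outside exceed those inside by at most one, and
    only when the path starts outside. *)
Lemma path_cover A x p :
  path (fun y z => (y \in A) || (z \in A)) x p ->
  size (x :: p) <= 2 * count (mem A) (x :: p) + (x \notin A).
Proof.
elim: p x => [|y p IHp] x /=; first by move=> _; case: (x \in A).
move=> /andP[xy /IHp /=]; case: (x \in A) xy => /= [_|->]; last by clear; lia.
by case: (y \in A); clear; lia.
Qed.

(* At most one consecutive pair avoids A: after that pair its first vertex never
   comes back, so the rest of the path is covered by A. *)
Lemma path_cover_plus_edge A a b x p :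
  (forall y z, g y z -> [\/ (y \in A) || (z \in A), y = a /\ z = b | y = b /\ z = a]) ->
  path g x p -> uniq (x :: p) ->
  size (x :: p) <= 2 * count (mem A) (x :: p) + 1 + (x \notin A).
Proof.
move=> cov; elim: p x => [|y p IHp] x; first by move=> _ _ /=; case: (x \in A).
move=> /= /andP[gxy pth] /andP[nx uy]; have := IHp y pth uy => /=.
have [xyA|xyA] := boolP ((x \in A) || (y \in A)).
  move: xyA; case: (x \in A) => /= [_|->]; last by clear; lia.
  by case: (y \in A); clear; lia.
have {}cov z t : z != x -> t != x -> g z t -> (z \in A) || (t \in A).
  move=> zx tx /cov[//|[Ez Et]|[Ez Et]]; case: (cov x y gxy) => [xy|[Ex Ey]|[Ex Ey]];
    by [rewrite xy in xyA | rewrite Ez Ex eqxx in zx | rewrite Et Ex eqxx in tx].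
have : path (fun y z => (y \in A) || (z \in A)) y p.
  have : all (fun z => z != x) (y :: p) by apply/allP => z zp; apply: contraNneq nx => <-.
  elim: p y pth {gxy nx uy IHp xyA} => //= z p IHp y /andP[gyz pth] /and3P[yx zx al].
  by rewrite cov //= IHp //= zx.
move=> /path_cover /=; move: xyA; rewrite negb_or => /andP[/negbTE-> /negbTE->] /=.
by clear; lia.
Qed.

Lemma haspaths_count A k l h : (forall p, sorted g p -> uniq p -> size p = l ->
  h <= count (mem A) p) -> haspaths g k l -> k * h <= #|A|.
Proof.
move=> Hp [ps [sz /allP al un]].
have le : size ps * h <= count (mem A) (flatten ps).
  elim: ps un al {sz} => //= p ps IHps; rewrite cat_uniq => /and3P[up _ un] al.
  rewrite mulSn count_cat; apply: leq_add.
    by have /andP[sp /eqP] := al p (mem_head _ _); apply: Hp.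
  by apply: IHps => // q qps; apply: al; rewrite inE qps orbT.
rewrite -sz; apply: leq_trans le _; rewrite -size_filter.
rewrite -(card_uniqP (filter_uniq _ un)); apply/subset_leq_card/subsetP => x.
by rewrite mem_filter => /andP[].
Qed.

Lemma bipartite_path_free A k l h : 2 * h <= l -> 0 < h -> #|A| < k * h ->
  (forall y z, g y z -> (y \in A) || (z \in A)) -> ~ haspaths g k l.
Proof.
move=> hl h0 cA cov hp; move: cA; rewrite ltnNge => /negP; apply.
apply: haspaths_count hp => -[|x p] sp _ szp; first by move: hl h0; rewrite -szp /=; clear;
  lia.
have /path_cover : path (fun y z => (y \in A) || (z \in A)) x p.
  by apply: sub_path sp => y z; apply: cov.
by move: hl; rewrite szp; move: (count _ _); case: (x \in A) => /=; clear; lia.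
Qed.

(** Here a path with c vertices in [A] has at most 2c + 2 vertices, so l = 2h + 1 still forces c to
    be at least h; for l = 2h this would fail. *)
Lemma bipartite_plus_edge_path_free A a b k l h : l = 2 * h + 1 -> #|A| < k * h ->
  (forall y z, g y z -> [\/ (y \in A) || (z \in A), y = a /\ z = b | y = b /\ z = a]) ->
  ~ haspaths g k l.
Proof.
move=> hl cA cov hp; move: cA; rewrite ltnNge => /negP; apply.
apply: haspaths_count hp => -[|x p] sp up szp; first by move: hl; rewrite -szp /=; clear; lia.
have := path_cover_plus_edge cov sp up.
by move: hl; rewrite szp; move: (count _ _); case: (x \in A) => /=; clear; lia.
Qed.

End KPath.

Section Edges.
Variable n : nat.
Implicit Types (E : {set 'I_n * 'I_n}).

Lemma relE_sym E : simpleE E -> symmetric (relE E).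
Proof. by case/andP=> _ /forallP H x y; move: (H x) => /forallP/(_ y)/eqP. Qed.

Lemma relE_irr E : simpleE E -> irreflexive (relE E).
Proof. by case/andP=> /forallP H _ x; apply/negbTE/H. Qed.

Lemma nedges_ed E : simpleE E -> 2 * nedges E = ed (relE E) setT setT.
Proof.
move=> sE; have gsym := relE_sym sE; have girr := relE_irr sE.
have -> : nedges E = \sum_(x : 'I_n) \sum_(y : 'I_n) (relE E x y && (x < y)).
  rewrite pair_big /= /nedges -sum1_card big_mkcond; apply: eq_bigr => -[x y] _.
  by rewrite inE /relE /=; case: (_ && _).
rewrite mul2n -addnn {2}exchange_big /= -big_split /ed /=.
apply: eq_big => [x|x _]; first by rewrite inE.
rewrite -big_split /=; apply: eq_big => [y|y _]; first by rewrite inE.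
rewrite (gsym y x); case gxy: (relE E x y) => //=.
by case: ltngtP => // /val_inj exy; rewrite exy girr in gxy.
Qed.

End Edges.

(** * The extremal number *)

(** With m = kl and w = m^2 (m + r), the hypothesis gives n at least 12wP because 4(h + 1) is at
    least 12. Every term on the left is then compared with m^3, m^2 r or m^2 P. The slack [c] and
    the tolerance kl + r + 4 are those of [turan_upper]. *)
Lemma threshold_bounds k l h r n P : 2 <= k -> 4 <= l -> 2 * h <= l -> 2 <= h -> 3 <= r -> 0
  < P ->
  4 * k ^ 2 * l ^ 2 * (k * l + r) * (h + 1) * P <= n ->
  let c := 2 * ((k * h) * (k * h)) in
  [/\ c + l ^ 2 + 2 * l * (P * (k * l)) < n,
      2 * (k * l + h * l + 2) + 2 * (k * h) + c <= n &
      7 * c + 8 * (k * h) + 8 * (h * l) + 8 * (k * l + r + 4) + 6 * (4 * h * (h * l)) < n].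
Proof.
move=> k2 l4 hl h2 r3 P0 nb c; rewrite /c -!mulnn.
set m := k * l.
pose w := m * m * (m + r).
have nw : 12 * (w * P) <= n.
  apply: leq_trans nb; rewrite -!mulnn.
  have -> : 4 * (k * k) * (l * l) * (k * l + r) * (h + 1) * P = 4 * (h + 1) * (w * P).
    by rewrite /w /m; clear; lia.
  by rewrite leq_mul2r; apply/orP; right; move: h2; clear; lia.
have wE : w = m * m * m + m * m * r by rewrite /w mulnDr.
have Km : 2 * (k * h) <= m by rewrite mulnCA leq_mul2l hl orbT.
have lm : 2 * l <= m by rewrite leq_mul2r k2 orbT.
have m8 : 8 <= m by move: lm l4; clear; lia.
have wP : w <= w * P by rewrite leq_pmulr.
have KK : 4 * (k * h * (k * h)) <= m * m by have := leq_mul Km Km; clear; lia.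
have ll : 4 * (l * l) <= m * m by have := leq_mul lm lm; clear; lia.
have hll : 2 * (h * l) <= l * l by rewrite mulnA leq_mul2r hl orbT.
have hhl : 32 * (h * (h * l)) <= m * m * m.
  have := leq_mul hll hl; have := leq_mul ll lm.
  have -> : 4 * (l * l) * (2 * l) = 8 * (l * l * l) by clear; lia.
  have -> : 2 * (h * l) * (2 * h) = 4 * (h * (h * l)) by clear; lia.
  by move: (h * (h * l)) (l * l * l) (m * m * m); clear; lia.
have mm8 : 8 * m <= m * m by rewrite leq_mul2r m8 orbT.
have mmm8 : 8 * (m * m) <= m * m * m by rewrite mulnC leq_mul2l m8 orbT.
have mmr : 3 * (m * m) <= m * m * r by rewrite mulnC leq_mul2l r3 orbT.
have mmr' : 64 * r <= m * m * r.
  by rewrite leq_mul2r; apply/orP; right; move: mm8 m8; clear; lia.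
have e1 : 2 * l * (P * m) <= m * m * P.
  have -> : m * m * P = m * (P * m) by rewrite -mulnA (mulnC m P).
  by rewrite leq_mul2r lm orbT.
have e2 : m * m * P <= w * P.
  by rewrite leq_mul2r wE; apply/orP; right; move: mmm8; clear; lia.
have e3 : 4 * h * (h * l) = 4 * (h * (h * l)) by rewrite -mulnA.
rewrite e3; clearbody w; clearbody m.
move: Km KK ll hll hhl m8 r3 e1 e2 nw wP wE mmm8 mmr mmr' mm8.
move: (m * m) (m * m * r) (m * m * m) (w * P) (m * m * P) (2 * l * (P * m)).
move=> x1 x2 x3 x4 x5 x6.
move: (h * (h * l)) (h * l) (l * l) (k * h * (k * h)) (k * h) => y1 y2 y3 y4 y5.
by clear => *; split; lia.
Qed.

Lemma card_ord_lt n m : m <= n -> #|[set i : 'I_n | i < m]| = m.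
Proof.
move=> mn; rewrite -sum1_card (eq_bigl (fun i : 'I_n => i < m)) => [|i]; last by rewrite inE.
by rewrite big_ord_narrow // sum1_card card_ord.
Qed.

Section Main.
Variables (r : nat) (F : rel 'I_r) (k l n : nat).
Hypothesis simpleF : simple_graph F.
Hypothesis chi3 : 3 <= chi F.
Hypothesis b1 : beta1 F = 1.
Hypothesis noiso : forall x, exists y, F x y.
Hypotheses (k2 : 2 <= k) (l4 : 4 <= l) (r3 : 3 <= r).
Hypothesis nbig : 4 * k ^ 2 * l ^ 2 * (k * l + r) * (l./2 + 1) * 'C(l, l./2) <= n.
Notation h := l./2.
Notation K := (k * h).

Let h2 : 2 <= h. Proof. exact: (half_leq l4). Qed.
Let hl : 2 * h <= l <= 2 * h + 1.
Proof. by have := odd_double_half l; rewrite -muln2; case: (odd l) => <-; move: h; clear;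
  lia. Qed.
Let bounds := threshold_bounds k2 l4 (proj1 (andP hl)) h2 r3
  (etrans (bin_gt0 l h) (leq_trans (leq_pmull h (isT : 0 < 2)) (proj1 (andP hl)))) nbig.

Let K4 : 4 <= K. Proof. exact: (leq_mul k2 h2). Qed.
Let Kn : 2 * K + 2 <= n.
Proof. by case: bounds => _ + _; move: (k * l) (h * l) (K * K) K => a b c d; clear; lia. Qed.

Lemma propP_control u v : control F u v ->
  ntriangles F = 1 -> minn (deg F u) (deg F v) <= K -> propP F k l.
Proof.
move=> cuv nt du; apply/or3P; apply: Or33; rewrite nt eqxx /=.
apply/existsP; exists u; apply/existsP; exists v; rewrite (proj1 cuv) du andbT.
exact: control_edge_control.
Qed.

(** Since l is odd, one of the other two alternatives of property P holds. If r is at most K + 1,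
    the control edge goes to a b and the rest into [A]; if there is a single triangle and a control
    vertex of degree at most K, [embed_pendant] applies. *)
Lemma full_edge_free (E : {set 'I_n * 'I_n}) (A : {set 'I_n}) a b : simpleE E ->
  ~~ contains (relE E) F -> odd l -> propP F k l -> #|A| = K - 1 ->
  k * l + r + 4 < #|cnbrs (relE E) A| ->
  a \in cnbrs (relE E) A -> b \in cnbrs (relE E) A -> ~~ relE E a b.
Proof.
move=> sE noF lo pP cA cC aC bC; have gsym := relE_sym sE; have girr := relE_irr sE.
apply/negP => gab; move/negP: noF; apply.
have ab : a != b by apply: contraTneq gab => ->; rewrite girr.
have x0 : 'I_r by exists 0; apply: leq_trans r3.
have [u [v cuv]] := control_exists noiso x0 b1.
case/or3P: pP => [|rK|/andP[/eqP nt /existsP[u' /existsP[v' /and3P[Fuv ec du]]]]].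
- by rewrite lo.
- apply: (embed_edge simpleF gsym (T := A) cuv gab ab); last first.
    by rewrite card_ord cA; move: rK K4; move: K; clear; lia.
  move=> t tA; rewrite !(gsym _ t) (cnbrsP _ _ _ aC) // (cnbrsP _ _ _ bC) //; split=> //.
    by apply: contraTneq tA => ->; apply: cnbrs_notin aC.
  by apply: contraTneq tA => ->; apply: cnbrs_notin bC.
have {}cuv := edge_control_control Fuv ec.
have pend u'' v'' : control F u'' v'' -> deg F u'' <= K -> contains (relE E) F.
  move=> c' d'; have [w [Fuw Fvw]] := control_triangle simpleF chi3 c'.
  apply: (embed_pendant simpleF gsym (A := A) c' Fuw Fvw _ aC bC gab ab) => //.
  - by move=> w' Fuw' Fvw'; apply: (ntriangles1 simpleF (proj1 c') nt).
  - by move=> s t sA /cnbrsP; apply.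
  - rewrite -setI_eq0; apply/eqP/setP => t; rewrite in_setI in_set0; apply/andP => -[tA].
    by move/(cnbrs_notin girr); rewrite tA.
  - by rewrite cA subnK //; apply: leq_trans K4.
  - by rewrite cA subn_gt0; apply: leq_trans K4.
  - by rewrite card_ord; move: cC; move: (k * l) #|_|; clear; lia.
by move: du; rewrite geq_min => /orP[]; [exact: pend cuv | exact: pend (controlC simpleF cuv)].
Qed.

(** A graph with more edges is dense enough for [large_common_nbhd]; [ed_out] then bounds its edges
    exactly. *)
Lemma turan_upper (E : {set 'I_n * 'I_n}) : simpleE E -> ~~ contains (relE E) F ->
  ~~ contains (relE E) (@kPath k l) -> nedges E <= (n - K + 1) * (K - 1) + C_Fkl F k l.
Proof.
move=> sE noF noP; have gsym := relE_sym sE; have girr := relE_irr sE.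
set g := relE E in noF noP gsym girr.
rewrite leqNgt; apply/negP => gt.
have i0 : 'I_n by exists 0; apply: leq_trans Kn; rewrite addn2.
have {}noP : ~ haspaths g k l by move=> hp; move/negP: noP; apply; apply: haspaths_kPath hp.
have x0 : 'I_r by exists 0; apply: leq_trans r3.
have [u [v cuv]] := control_exists noiso x0 b1.
have e0 := nedges_ed sE; rewrite -/g in e0.
have [big1 big2 big3] := bounds.
have mE : (n - K + 1) * (K - 1) + (K - 1) * (K - 1) = n * (K - 1).
  by rewrite -mulnDl; congr (_ * _); move: Kn K4; move: K; clear; lia.
have KK1 : (K - 1) * (K - 1) <= K * K by apply: leq_mul; apply: leq_subr.
have cV : #|('I_n : finType)| = n by apply: card_ord.
(* The slack 2K^2 covers 2(K - 1)^2, the gap between 2n(K - 1) and twice the claimed main term. *)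
have [A [cA cC]] : exists A : {set 'I_n}, #|A| = K - 1 /\ k * l + r + 4 < #|cnbrs g A|.
  apply: (large_common_nbhd gsym girr h2 hl k2 noP (c := 2 * (K * K))); rewrite cV //.
  rewrite -e0 (_ : 2 * K - 2 = 2 * (K - 1)); last by rewrite mulnBr muln1.
  rewrite -(mulnA 2 (K - 1)) (mulnC (K - 1)) -mE.
  move: KK1 gt; move: ((K - 1) * (K - 1)) (_ * (K - 1)) (K * K) (nedges E) (C_Fkl F k l).
  by clear; lia.
have cC' : k * l + 4 < #|cnbrs g A|.
  by apply: leq_ltn_trans cC; rewrite leq_add2r leq_addr.
(* An edge inside [A] together with the common neighbours of [A] would contain F. *)
have eA : ed g A A = 0.
  apply: ed_eq0 => x y xA yA; apply/negP => gxy; move/negP: noF; apply.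
  apply: (embed_edge simpleF gsym (T := cnbrs g A) cuv gxy).
  - by apply: contraTneq gxy => ->; rewrite girr.
  - move=> t tC; rewrite !(cnbrsP _ _ _ tC) //; have := cnbrs_notin girr tC => tA.
    by split=> //; apply: contraNneq tA => ->.
  - by rewrite card_ord; move: cC; move: (k * l) #|_|; clear; lia.
have e1 := ed_split_sym A setT gsym; rewrite setTI setTD eA in e1.
have e2 := ed_missing g A; rewrite (edC _ _ gsym) in e2.
have cR : #|~: A| = n - K + 1.
  by have := cardsC A; rewrite card_ord cA; move: Kn K4; move: K #|_|; clear; lia.
rewrite cR cA in e2.
(* Twice the number of edges is 2(n - K + 1)(K - 1) minus twice the missing edges plus the ordered
   pairs outside [A], so only the exceptional extra edge can exceed the main term. *)
have := ed_out gsym girr h2 hl k2 noP cA cC'.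
case=> [e3|[lo [a [b [aC bC gab]]] e3]].
  move: gt e0 e1 e2 e3; move: (_ * (K - 1)) (missing _ _) (nedges E) (C_Fkl F k l).
  by move: (ed _ _ _) (ed _ _ _) (ed _ _ _); clear; lia.
have [pP|nP] := boolP (propP F k l).
  by apply: (negP (full_edge_free sE noF lo pP cA cC aC bC)).
have EC : C_Fkl F k l = 1 by rewrite /C_Fkl (negbTE nP).
move: gt e0 e1 e2 e3; rewrite EC; move: (_ * (K - 1)) (missing _ _) (nedges E).
by move: (ed _ _ _) (ed _ _ _) (ed _ _ _); clear; lia.
Qed.

(** * Lower bound: the complete bipartite graph, and the same graph with one edge added *)

Definition hub : {set 'I_n} := [set i : 'I_n | i < K - 1].

Definition bip_edges : {set 'I_n * 'I_n} := [set p | (p.1 \in hub) != (p.2 \in hub)].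

Lemma card_hub : #|hub| = K - 1.
Proof. by apply: card_ord_lt; move: Kn; move: K; clear; lia. Qed.

Lemma simple_bip : simpleE bip_edges.
Proof.
apply/andP; split; first by apply/forallP => x; rewrite inE eqxx.
by apply/forallP => x; apply/forallP => y;
  rewrite ![_ \in bip_edges]inE /= (eq_sym (x \in hub)).
Qed.

Lemma nedges_bip : nedges bip_edges = (n - K + 1) * (K - 1).
Proof.
have gsym := relE_sym simple_bip; apply/eqP.
rewrite -(eqn_pmul2l (isT : 0 < 2)) nedges_ed ?simple_bip // (ed_split_sym hub setT gsym).
rewrite setTI setTD !(@ed_eq0 _ _ hub hub) => [|x y xh yh]; last by rewrite /relE inE /= xh yh.
rewrite (@ed_eq0 _ _ (~: hub)) => [|x y]; last first.
  by rewrite !in_setC /relE [_ \in bip_edges]inE /= => /negbTE-> /negbTE->.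
have cR : #|~: hub| = n - K + 1.
  by have := cardsC hub; rewrite card_ord card_hub; move: Kn K4; move: K #|_|; clear; lia.
rewrite addn0 add0n eqn_pmul2l // -cR -card_hub mulnC eqn_leq ed_leq_mul /= ed_nbrs.
rewrite -sum_nat_const; apply: leq_sum => x xh; apply/subset_leq_card/subsetP => y.
by rewrite in_setC => yh;
  rewrite in_set in_setC yh /relE [_ \in bip_edges]inE /= xh (negbTE yh).
Qed.

Lemma bip_edges_free : ~~ contains (relE bip_edges) F /\
  ~~ contains (relE bip_edges) (@kPath k l).
Proof.
have bip s t : relE bip_edges s t -> (s \in hub) != (t \in hub) by rewrite /relE inE.
split; first exact: (bipartite_free chi3 bip).
apply/negP => /kPath_haspaths; apply: (bipartite_path_free (A := hub) (h := h)).
- by case/andP: hl.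
- exact: leq_trans h2.
- by rewrite card_hub; move: K4; move: K; clear; lia.
- by move=> y z /bip; case: (y \in hub); case: (z \in hub).
Qed.

Lemma lt_K1 : K - 1 < n. Proof. by move: Kn; move: K; clear; lia. Qed.
Lemma lt_K : K < n. Proof. by move: Kn; move: K; clear; lia. Qed.
Notation va := (Ordinal lt_K1).
Notation vb := (Ordinal lt_K).

(** The added edge joins the first two vertices outside [hub], numbered K - 1 and K. *)
Definition plus_edges : {set 'I_n * 'I_n} := [set (va, vb); (vb, va)] :|: bip_edges.

Lemma va_out : va \notin hub. Proof. by rewrite inE /= ltnn. Qed.
Lemma vb_out : vb \notin hub. Proof. by rewrite inE /= -leqNgt leq_subr. Qed.
Lemma va_lt_vb : va < vb. Proof. by rewrite /=; move: K4; move: K; clear; lia. Qed.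

Lemma simple_plus : simpleE plus_edges.
Proof.
have ne : va != vb by rewrite -val_eqE neq_ltn va_lt_vb.
have /andP[/forallP i1 /forallP s1] := simple_bip.
apply/andP; split.
  apply/forallP => x; rewrite /plus_edges in_setU in_set2 !xpair_eqE !negb_or i1 andbT.
  by apply/andP; split; apply/negP => /andP[/eqP->]; [|rewrite eq_sym]; rewrite (negbTE ne).
apply/forallP => x; apply/forallP => y; rewrite /plus_edges !in_setU !in_set1 !xpair_eqE.
have /forallP/(_ y)/eqP-> := s1 x.
by rewrite (andbC (y == va)) (andbC (y == vb)) (orbC (_ && _) ((x == va) && _)).
Qed.

Lemma nedges_plus : nedges plus_edges >= (n - K + 1) * (K - 1) + 1.
Proof.
rewrite -nedges_bip addn1 /nedges.
have nin : (va, vb) \notin [set p in bip_edges | p.1 < p.2].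
  by rewrite in_set [_ \in bip_edges]in_set /= (negbTE va_out) (negbTE vb_out).
have <- : #|(va, vb) |: [set p in bip_edges | p.1 < p.2]| = #|[set p in bip_edges | p.1 <
  p.2]|.+1.
  by rewrite cardsU1 nin.
apply/subset_leq_card/subsetP => p; rewrite in_setU1 => /orP[/eqP->|].
  by rewrite in_set va_lt_vb andbT /plus_edges in_setU in_set2 eqxx.
by rewrite !in_set => /andP[-> ->]; rewrite orbT.
Qed.

(** Failure of property P makes l odd, which excludes the paths. A copy of F would give r at most K
    + 1, or a single triangle and a control vertex of degree at most K, and so property P. *)
Lemma plus_edges_free : ~~ propP F k l -> ~~ contains (relE plus_edges) F /\
  ~~ contains (relE plus_edges) (@kPath k l).
Proof.
move=> nP.
have cov s t : relE plus_edges s t ->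
    [\/ (s \in hub) != (t \in hub), s = va /\ t = vb | s = vb /\ t = va].
  rewrite /relE /plus_edges in_setU in_set2 => /orP[/orP[]/eqP[-> ->]|].
  - exact: Or32.
  - exact: Or33.
  by rewrite inE => H; apply: Or31.
split.
  apply/negP => cF; move/negP: nP; apply.
  have r0 : 0 < #|'I_r| by rewrite card_ord; apply: leq_trans r3.
  case: (bipartite_plus_edge_free simpleF noiso chi3 b1 r0 va_out vb_out cov cF).
    rewrite card_ord card_hub => rK; apply/or3P; apply: Or32.
    by move: rK K4; move: K; clear; lia.
  case=> nt [u [v [cuv du]]]; apply: (propP_control cuv nt).
  by rewrite card_hub subnK in du; [rewrite geq_min du | exact: leq_trans K4].
apply/negP => /kPath_haspaths.
apply: (bipartite_plus_edge_path_free (A := hub) (a := va) (b := vb) (h := h)).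
- have lo : odd l by apply: contraR nP => le; apply/or3P; apply: Or31.
  by have := odd_double_half l; rewrite lo -muln2 mulnC addnC => ->.
- by rewrite card_hub; move: K4; move: K; clear; lia.
- move=> y z /cov[]; [|by move=> ?; apply: Or32|by move=> ?; apply: Or33].
  by move=> H; apply: Or31; move: H; case: (y \in hub); case: (z \in hub).
Qed.

Lemma turan_lower : (n - K + 1) * (K - 1) + C_Fkl F k l <= ex_F_kP n F k l.
Proof.
rewrite /C_Fkl; have [pP|nP] := boolP (propP F k l).
  rewrite addn0 -nedges_bip /ex_F_kP; have [H1 H2] := bip_edges_free.
  by apply: (bigmax_sup bip_edges); rewrite // simple_bip H1 H2.
have [H1 H2] := plus_edges_free nP.
by apply: (bigmax_sup plus_edges); [rewrite simple_plus H1 H2 | exact: nedges_plus].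
Qed.

End Main.

Theorem theorem1p7 (r : nat) (F : rel 'I_r) (k l n : nat) :
  simple_graph F ->
  (3 <= chi F)%N ->
  beta1 F = 1%N ->
  (forall x, exists y, F x y) ->
  (2 <= k)%N -> (4 <= l)%N -> (3 <= r)%N ->
  (4 * k ^ 2 * l ^ 2 * (k * l + r) * (l./2 + 1) * 'C(l, l./2) <= n)%N ->
  ex_F_kP n F k l =
    ((n - k * l./2 + 1) * (k * l./2 - 1) + C_Fkl F k l)%N.
Proof.
move=> sF chi3 b1 noiso k2 l4 r3 nbig; apply/eqP; rewrite eqn_leq; apply/andP; split.
  apply/bigmax_leqP => E /andP[/andP[sE noF] noP]; exact: turan_upper.
exact: turan_lower.
Qed.
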